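(* There is a universal constant $c>0$ such that the following holds. Let $G$ be an $N\times N$ random matrix with standard real Gaussian entries, and assume the $N(N+1)/2$ pairs $\{(G_{ij},G_{ji}):1\le i\le j\le N\}$ are jointly independent. Then for any $N\times N$ complex matrix $A$, deterministic or random and independent of $G$, and any $k\ge c^{-1}\log N$, the event that $$\sigma_{N-\ell}(G+A)\ge c\,\ell/N\qquad\text{for all }k\le\ell\le N-1$$ holds with probability at least $1-e^{-ck}$.
   Context: $\sigma_1(M)\ge\dots\ge\sigma_N(M)\ge0$ denote the singular values of an $N\times N$ matrix $M$; $\ell$ ranges over integers. The entries $G_{ij}$ and $G_{ji}$ within one pair are allowed to be dependent. *)

(* Defs.v *)
From HB Require Import structures.
From mathcomp Require Import all_boot all_order all_algebra.
From mathcomp Require Import finmap complex.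
From mathcomp Require Import all_classical all_reals all_analysis.

Set Implicit Arguments.
Unset Strict Implicit.
Unset Printing Implicit Defensive.

Import Order.TTheory GRing.Theory Num.Theory numFieldNormedType.Exports.

Local Open Scope classical_set_scope.
Local Open Scope ring_scope.
Local Open Scope complex_scope.
Local Open Scope sesquilinear_scope.

Section singular_values.
Context {R : realType} {n : nat}.

(* Square roots of the eigenvalues of M^* M, repeated according to
   multiplicity and sorted in decreasing order. As M^* M is Hermitian positive
   semidefinite, its eigenvalues are nonnegative reals, so that taking
   [complex.Re] only changes their type. *)
Definition singular_values (M : 'M[R[i]]_n) : seq R :=
  sort >=%R [seq Num.sqrt (complex.Re (spectral_diag (M ^t* *m M) ord0 j))
            | j : 'I_n].

(* Numbered from 1 to n; [nth] counts from 0. *)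
Definition singular_value (j : nat) (M : 'M[R[i]]_n) : R :=
  nth 0 (singular_values M) j.-1.

End singular_values.

Section independence.
Context {d : measure_display} {T : measurableType d} {R : realType}.

(* The sigma-algebra on T generated by the family X *)
Definition generated_sigma_algebra {I : Type} (X : I -> T -> R) :
    set (set T) :=
  <<s \bigcup_(i in [set: I])
        preimage_set_system [set: T] (X i) (@measurable _ R) >>.

Definition independent_classes (P : probability T R) (F F' : set (set T)) :
    Prop :=
  forall E E', F E -> F' E' -> P (E `&` E') = (P E * P E')%E.

Definition mutually_independent_classes (P : probability T R)
    {I : choiceType} (F : I -> set (set T)) : Prop :=
  forall (J : {fset I}) (E : I -> set T), (forall i, i \in J -> F i (E i)) ->
    P (\bigcap_(i in [set` J]) E i) = (\prod_(i <- J) P (E i))%E.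

End independence.

Section random_matrices.
Context {d : measure_display} {T : measurableType d} {R : realType} {N : nat}.

(* R[i] carries no measurable structure in the libraries: measurability and
   the generated sigma-algebra are expressed through the real and imaginary
   parts of the entries. *)
Definition cmx_coord (A : T -> 'M[R[i]]_N) (q : bool * ('I_N * 'I_N)) :
    T -> R :=
  fun w => let z := A w q.2.1 q.2.2 in
           if q.1 then complex.Im z else complex.Re z.

Definition random_cmx (A : T -> 'M[R[i]]_N) : Prop :=
  forall q, measurable_fun [set: T] (cmx_coord A q).

Variable P : probability T R.
Implicit Type G : 'I_N -> 'I_N -> {RV P >-> R}.

Definition cmx_of_RV G (w : T) : 'M[R[i]]_N := \matrix_(i, j) (G i j w)%:C.

Definition standard_gaussian_entries G : Prop :=
  forall i j (B : set R), measurable B ->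
    distribution P (G i j) B = normal_prob 0 1 B.

(* Nothing is assumed on the joint law of G i j and G j i. *)
Definition independent_pairs G : Prop :=
  mutually_independent_classes P
    (fun p : {p : 'I_N * 'I_N | (p.1 <= p.2)%N} =>
       generated_sigma_algebra (fun b : bool =>
         if b then G (val p).1 (val p).2 : T -> R
         else G (val p).2 (val p).1)).

Definition independent_of_cmx G (A : T -> 'M[R[i]]_N) : Prop :=
  independent_classes P
    (generated_sigma_algebra (fun p : 'I_N * 'I_N => G p.1 p.2 : T -> R))
    (generated_sigma_algebra (cmx_coord A)).

End random_matrices.

(* Main.v *)
From HB Require Import structures.
Require Import Defs.
From mathcomp Require Import all_boot all_order all_algebra.
From mathcomp Require Import finmap complex.
From mathcomp Require Import all_classical all_reals all_analysis.
From mathcomp Require Import measurable_realfun ring lra zify.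

Set Implicit Arguments.
Unset Strict Implicit.
Unset Printing Implicit Defensive.

Import Order.TTheory GRing.Theory Num.Theory numFieldNormedType.Exports.

Local Open Scope classical_set_scope.
Local Open Scope ring_scope.

(* Write M = G + A, e = (c l / N)^2 and p = l + 1. If the p smallest singular
   values of M are below sqrt e, then tr (e (M^* M + e)^-1) >= p / 2, so some
   diagonal entry of this matrix, say the i-th, is at least p / (2N). A test
   vector built from it shows that the i-th column w of M, without its i-th
   entry, satisfies w^* H w <= 2 N e / p, where H = e (Y Y^* + e)^-1 and Y is M
   without its i-th row and column; moreover 0 <= H <= 1 and
   tr H >= p / 2 - 1. The entries G_ji with j <> i lie in distinct pairs, none
   of which meets Y, so they are independent of each other and of H whatever
   the dependence between G_ji and G_ij. Taking Schur complements of H at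
   pivots of size at least p / (4N), each of which lowers the trace by at most
   1, confines p / 4 of the entries of w successively to intervals of length
   O(c). So the event for i has probability at most exp (- p / 4) up to
   rounding, and for l >= k >= c^-1 log N this beats the union bound over i
   and l. *)

(** * Hermitian forms and regularized inverses *)

Section hermitian_forms.
Local Open Scope sesquilinear_scope.
Context {C : numClosedFieldType}.

Definition hdot {n} (x y : 'cV[C]_n) : C := (x ^t* *m y) 0 0.
Notation sqn x := (hdot x x).

Lemma trCmx_mul m n p (A : 'M[C]_(m, n)) (B : 'M[C]_(n, p)) :
  (A *m B) ^t* = B ^t* *m A ^t*.
Proof. by rewrite trmx_mul map_mxM. Qed.

Lemma hdotE n (x y : 'cV[C]_n) : hdot x y = \sum_i (x i 0)^* * y i 0.
Proof. by rewrite /hdot mxE; apply: eq_bigr => i _; rewrite !mxE. Qed.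

Lemma hdotDr n (x y z : 'cV[C]_n) : hdot x (y + z) = hdot x y + hdot x z.
Proof. by rewrite /hdot mulmxDr mxE. Qed.

Lemma hdotBr n (x y z : 'cV[C]_n) : hdot x (y - z) = hdot x y - hdot x z.
Proof. by rewrite /hdot mulmxBr !mxE. Qed.

Lemma hdotZr n a (x y : 'cV[C]_n) : hdot x (a *: y) = a * hdot x y.
Proof. by rewrite /hdot -scalemxAr mxE. Qed.

Lemma hdotC n (x y : 'cV[C]_n) : hdot x y = (hdot y x)^*.
Proof.
by rewrite !hdotE rmorph_sum; apply: eq_bigr => i _; rewrite rmorphM /= conjCK mulrC.
Qed.

Lemma hdotBl n (x y z : 'cV[C]_n) : hdot (y - z) x = hdot y x - hdot z x.
Proof. by rewrite hdotC hdotBr rmorphB /= -!hdotC. Qed.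

Lemma hdotZl n a (x y : 'cV[C]_n) : hdot (a *: x) y = a^* * hdot x y.
Proof. by rewrite hdotC hdotZr rmorphM /= -!hdotC. Qed.

Lemma hdot_mulmxl m n (A : 'M[C]_(m, n)) (x : 'cV_n) (y : 'cV_m) :
  hdot (A *m x) y = hdot x (A ^t* *m y).
Proof. by rewrite /hdot trCmx_mul mulmxA. Qed.

Lemma hdot_mulmxr m n (A : 'M[C]_(m, n)) (x : 'cV_m) (y : 'cV_n) :
  hdot x (A *m y) = hdot (A ^t* *m x) y.
Proof. by rewrite hdot_mulmxl trmxCK. Qed.

Lemma sqn_ge0 n (x : 'cV[C]_n) : 0 <= sqn x.
Proof. by rewrite hdotE sumr_ge0// => i _; rewrite mulrC mul_conjC_ge0. Qed.

Lemma sqn_eq0 n (x : 'cV[C]_n) : sqn x = 0 -> x = 0.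
Proof.
rewrite hdotE => /eqP; rewrite psumr_eq0; last first.
  by move=> i _; rewrite mulrC mul_conjC_ge0.
move=> /allP h; apply/matrixP => i j; rewrite ord1 mxE.
by have := h i (mem_index_enum _); rewrite mulrC mul_conjC_eq0 => /eqP.
Qed.

Lemma hdot_AMGM n (x y : 'cV[C]_n) : hdot x y + hdot y x <= sqn x + sqn y.
Proof.
rewrite -subr_ge0 (_ : _ - _ = hdot (x - y) (x - y)) ?sqn_ge0//.
by rewrite hdotBr !hdotBl; ring.
Qed.

Lemma hdot_delta n i (y : 'cV[C]_n) : hdot (delta_mx i 0) y = y i 0.
Proof.
rewrite hdotE (bigD1 i)//= big1 => [|k ki].
  by rewrite !mxE !eqxx/= conjC1 mul1r addr0.
by rewrite !mxE (negPf ki)/= conjC0 mul0r.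
Qed.

Lemma mulmx_scale_delta n (H : 'M[C]_n) a j i :
  (H *m (a *: delta_mx j 0 : 'cV_n)) i 0 = a * H i j.
Proof. by rewrite -scalemxAr -colE 2!mxE. Qed.

(** Taken at the adjoint of [M] this is [M^* M + e], taken at [Y] it is [Y Y^* + e]. For [e > 0] the
    shift makes it positive definite for every [Z]. *)
Definition reg {m n} (e : C) (Z : 'M[C]_(n, m)) : 'M[C]_n := Z *m Z ^t* + e%:M.

Lemma reg_hermitian m n e (Z : 'M[C]_(n, m)) : 0 <= e ->
  (reg e Z) ^t* = reg e Z.
Proof.
move=> e0; rewrite /reg linearD/= map_mxD/= trCmx_mul trmxCK; congr (_ + _).
by rewrite tr_scalar_mx map_scalar_mx/= geC0_conj.
Qed.

Lemma hdot_reg m n e (Z : 'M[C]_(n, m)) x :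
  hdot x (reg e Z *m x) = sqn (Z ^t* *m x) + e * sqn x.
Proof.
by rewrite /reg mulmxDl hdotDr mul_scalar_mx hdotZr -mulmxA hdot_mulmxr.
Qed.

(** The adjoint of a row in the kernel is killed by the quadratic form, which is a sum of squares
    containing [e |x|^2]. *)
Lemma reg_unit m n e (Z : 'M[C]_(n, m)) : 0 < e -> reg e Z \in unitmx.
Proof.
move=> e0; rewrite -row_free_unit -kermx_eq0; apply/eqP/row_matrixP => i.
set u := row i _; have : u *m reg e Z = 0.
  by rewrite /u -row_mul mulmx_ker row0.
move=> uB; rewrite row0.
have Bu : reg e Z *m u ^t* = 0.
  by rewrite -[reg e Z](reg_hermitian _ (ltW e0)) -trCmx_mul uB trmx0 map_mx0.
have : hdot (u^t*) (reg e Z *m u ^t*) = 0 by rewrite Bu /hdot mulmx0 mxE.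
rewrite hdot_reg => /eqP; rewrite paddr_eq0 ?sqn_ge0//; last first.
  by rewrite mulr_ge0 ?sqn_ge0// ltW.
move=> /andP[_]; rewrite mulf_eq0 gt_eqF//= => /eqP/sqn_eq0 u0.
by rewrite -[u]trmxCK u0 trmx0 map_mx0.
Qed.

Definition reginv {m n} (e : C) (Z : 'M[C]_(n, m)) : 'M[C]_n :=
  invmx (reg e Z).

Lemma reginvK m n e (Z : 'M[C]_(n, m)) (x : 'cV_n) : 0 < e ->
  reg e Z *m (reginv e Z *m x) = x.
Proof. by move=> e0; rewrite mulKVmx// reg_unit. Qed.

Lemma reginv_hermitian m n e (Z : 'M[C]_(n, m)) : 0 < e ->
  (reginv e Z) ^t* = reginv e Z.
Proof.
move=> e0; rewrite /reginv trmx_inv map_invmx/=.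
by congr invmx; apply: reg_hermitian; exact: ltW.
Qed.

Lemma hdot_reginv m n e (Z : 'M[C]_(n, m)) x : 0 < e ->
  let y := reginv e Z *m x in
  hdot x y = sqn (Z ^t* *m y) + e * sqn y.
Proof.
by move=> e0 y; rewrite -hdot_reg hdot_mulmxr reg_hermitian ?ltW// reginvK.
Qed.

Lemma hdot_reginv_ge0 m n e (Z : 'M[C]_(n, m)) x : 0 < e ->
  0 <= hdot x (reginv e Z *m x).
Proof.
by move=> e0; rewrite hdot_reginv// addr_ge0 ?sqn_ge0// mulr_ge0 ?sqn_ge0// ltW.
Qed.

(** [e x^* (Z Z^* + e)^-1 x] is the minimum of [|z|^2 + e |v|^2] over all ways of writing
    [x = z - Z v]. Only the bound by an arbitrary decomposition is proved. *)
Lemma hdot_reginv_range m n e (Z : 'M[C]_(n, m)) z v : 0 < e ->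
  e * hdot (z - Z *m v) (reginv e Z *m (z - Z *m v)) <= sqn z + e * sqn v.
Proof.
move=> e0; set x := z - _; have := hdot_reginv Z x e0; set y := reginv e Z *m x => /= xy.
have yx : hdot y x = hdot x y.
  by rewrite hdotC conj_Creal// ger0_real// hdot_reginv_ge0.
(* The first inequality gets weight [e]. The left sides then add up to [2 e x^* y], the right sides
   to [|z|^2 + e |v|^2] plus [e (|Z^* y|^2 + e |y|^2)], which is [e x^* y]. *)
have h1 := hdot_AMGM (Z ^t* *m y) (- 1 *: v).
have h2 := hdot_AMGM (e *: y) z.
have ec : e^* = e by rewrite geC0_conj// ltW.
rewrite -(ler_pM2l e0) in h1.
have : e * (hdot x y + hdot y x) <=
    e * sqn (Z ^t* *m y) + e * (e * sqn y) + e * sqn v + sqn z.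
  move: (lerD h1 h2); rewrite !hdotZl !hdotZr ec rmorphN1.
  rewrite [hdot (Z^t* *m y) v]hdot_mulmxl trmxCK [hdot v (Z^t* *m y)]hdot_mulmxr trmxCK.
  set a := hdot y (Z *m v); set b := hdot (Z *m v) y.
  have -> : hdot x y = hdot z y - b by rewrite /x hdotBl.
  have -> : hdot y x = hdot y z - a by rewrite /x hdotBr.
  by congr (_ <= _); ring.
rewrite yx mulrDr [leRHS](_ : _ = e * hdot x y + (sqn z + e * sqn v)).
  by rewrite lerD2l.
by rewrite xy; ring.
Qed.

Lemma hdot_reginv_le m n e (Z : 'M[C]_(n, m)) x : 0 < e ->
  e * hdot x (reginv e Z *m x) <= sqn x.
Proof.
move=> e0; have := hdot_reginv_range Z x 0 e0.
by rewrite mulmx0 subr0 [hdot 0 0]hdotE big1 ?mulr0 ?addr0// => i _; rewrite mxE mulr0.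
Qed.

Lemma mxdiag_hdot n (A : 'M[C]_n) i :
  A i i = hdot (delta_mx i 0) (A *m delta_mx i 0).
Proof. by rewrite hdot_delta -colE mxE. Qed.

(** Inversion reverses the order of positive definite matrices. This is checked on each basis vector
    [x] by expanding the nonnegative form of [reg e Y] at the difference of the two solutions [v]
    and [y]. *)
Lemma mxtrace_reginv_le m p n e (Y : 'M[C]_(n, m)) (Z : 'M[C]_(n, p)) : 0 < e ->
  (forall x, sqn (Y ^t* *m x) <= sqn (Z ^t* *m x)) ->
  \tr (reginv e Z) <= \tr (reginv e Y).
Proof.
move=> e0 YZ; apply: ler_sum => i _; rewrite !mxdiag_hdot.
set x := delta_mx i 0; set y := reginv e Z *m x; set v := reginv e Y *m x.
have hy : hdot x y = sqn (Z ^t* *m y) + e * sqn y by exact: hdot_reginv.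
have yx : hdot y x = hdot x y.
  by rewrite hdotC conj_Creal// ger0_real// hdot_reginv_ge0.
have vx : hdot v x = hdot x v.
  by rewrite hdotC conj_Creal// ger0_real// hdot_reginv_ge0.
have vBy : hdot v (reg e Y *m y) = hdot x y.
  by rewrite hdot_mulmxr reg_hermitian ?ltW// reginvK.
have : 0 <= hdot (v - y) (reg e Y *m (v - y)).
  by rewrite hdot_reg addr_ge0 ?sqn_ge0// mulr_ge0 ?sqn_ge0// ltW.
rewrite mulmxBr reginvK// hdotBr !hdotBl vx yx vBy hdot_reg => h.
have := YZ y; rewrite -(lerD2r (e * sqn y)) -hy => h2.
rewrite -subr_ge0; apply: le_trans h _.
rewrite -subr_ge0 (_ : _ - _ = hdot x y - (sqn (Y ^t* *m y) + e * sqn y)).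
  by rewrite subr_ge0.
by ring.
Qed.

(** [e (Z Z^* + e)^-1] is [1 - (Z Z^* + e)^-1 Z Z^*], and the intertwining
    [(Z^* Z + e)^-1 Z^* = Z^* (Z Z^* + e)^-1] together with cyclicity of the trace exchanges the two
    orders. *)
Lemma mxtrace_reginv_flip n e (Z : 'M[C]_n) : 0 < e ->
  \tr (reginv e (Z ^t*)) = \tr (reginv e Z).
Proof.
move=> e0; have en0 : e != 0 by rewrite gt_eqF.
apply: (mulfI en0).
have tr1 (Y : 'M[C]_n) :
    e * \tr (reginv e Y) = n%:R - \tr (reginv e Y *m (Y *m Y ^t*)).
  have : reginv e Y *m reg e Y = 1%:M by rewrite mulVmx// reg_unit.
  rewrite /reg mulmxDr mul_mx_scalar => /(congr1 mxtrace).
  by rewrite mxtraceD mxtraceZ mxtrace1 => <-; rewrite addrC addKr.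
rewrite !tr1 trmxCK; congr (_ - _).
suff ZZ : reginv e (Z ^t*) *m Z ^t* = Z ^t* *m reginv e Z.
  by rewrite mulmxA ZZ -mulmxA mxtrace_mulC -mulmxA.
have BZ : Z ^t* *m reg e Z = reg e (Z ^t*) *m Z ^t*.
  by rewrite /reg trmxCK mulmxDr mulmxDl mul_mx_scalar mul_scalar_mx !mulmxA.
rewrite -[LHS](mulmxK (reg_unit Z e0)) -(mulmxA _ _ (reg e Z)) BZ.
by rewrite mulmxA mulVmx ?reg_unit// mul1mx.
Qed.

(** * Removing one row and one column *)

Definition projC {n} (i : 'I_n) : 'M[C]_n := 1%:M - delta_mx i i.

Lemma projC_adj n (i : 'I_n) : (projC i) ^t* = projC i.
Proof.
rewrite /projC linearB /= map_mxB /= trmx1 map_mx1 trmx_delta; congr (_ - _).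
by apply/matrixP => a b; rewrite !mxE; case: andb; rewrite ?conjC1 ?conjC0.
Qed.

Lemma projCE n (i : 'I_n) (x : 'cV[C]_n) k :
  (projC i *m x) k 0 = (k != i)%:R * x k 0.
Proof.
rewrite /projC mulmxBl mul1mx 2!mxE.
rewrite [(delta_mx i i *m x) k 0]mxE (bigD1 i)//= big1 => [|j /negPf ji]; last first.
  by rewrite mxE ji andbF mul0r.
rewrite mxE eqxx andbT addr0; case: eqP => [->|_].
  by rewrite mul1r mul0r subrr.
by rewrite mul0r mul1r subr0.
Qed.

Lemma sqn_projC n (i : 'I_n) (x : 'cV[C]_n) : sqn (projC i *m x) <= sqn x.
Proof.
rewrite !hdotE; apply: ler_sum => k _; rewrite projCE; case: eqP => _.
  by rewrite !mul0r mulr0 mulrC mul_conjC_ge0.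
by rewrite !mul1r.
Qed.

Definition psd_contraction {n} (H : 'M[C]_n) :=
  H ^t* = H /\ forall x, 0 <= hdot x (H *m x) <= sqn x.

(** The matrix [H] of the overview, padded with a zero row and column [i]: indices are removed by
    projection, so all matrices keep the size [n]. The outer projections erase the entry 1 that
    [e *: reginv] has at position [(i, i)], so the form ignores coordinate [i]. *)
Definition compressed_reginv {n} (e : C) (M : 'M[C]_n) (i : 'I_n) : 'M[C]_n :=
  e *: (projC i *m reginv e (projC i *m M *m projC i) *m projC i).

Lemma hdot_compressed_reginv n e (M : 'M[C]_n) i x : 0 < e ->
  hdot x (compressed_reginv e M i *m x) =
  e * hdot (projC i *m x)
           (reginv e (projC i *m M *m projC i) *m (projC i *m x)).
Proof.
by move=> e0; rewrite /compressed_reginv -scalemxAl hdotZr -!mulmxA hdot_mulmxr projC_adj.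
Qed.

Lemma compressed_reginv_psd n e (M : 'M[C]_n) i : 0 < e ->
  psd_contraction (compressed_reginv e M i).
Proof.
move=> e0; split=> [|x].
  rewrite /compressed_reginv linearZ/= map_mxZ/= geC0_conj ?ltW//; congr (_ *: _).
  by rewrite !trCmx_mul reginv_hermitian// projC_adj mulmxA.
rewrite hdot_compressed_reginv//; apply/andP; split.
  by rewrite mulr_ge0 ?hdot_reginv_ge0// ltW.
exact: le_trans (hdot_reginv_le _ _ e0) (sqn_projC _ _).
Qed.

(** Projecting out row [i] of [M] decreases [M^* M], hence increases the trace of the inverse. After
    passing from [Z^* Z] to [Z Z^*], projecting out column [i] does the same. Only the outer
    projections lose anything, namely one diagonal entry of size at most 1. *)
Lemma mxtrace_compressed_reginv n e (M : 'M[C]_n) i : 0 < e ->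
  \tr (e *: reginv e (M ^t*)) - 1 <= \tr (compressed_reginv e M i).
Proof.
move=> e0; set D := projC i.
have trD : \tr (e *: reginv e (D *m M *m D)) - 1 <= \tr (compressed_reginv e M i).
  rewrite lerBlDr /mxtrace (bigD1 i)//= [leRHS]addrC lerD//.
    have := hdot_reginv_le (D *m M *m D) (delta_mx i 0) e0.
    by rewrite -mxdiag_hdot hdot_delta !mxE !eqxx.
  rewrite [leRHS](bigD1 i)//=; apply: le_trans (_ : \sum_(k < n | k != i)
      compressed_reginv e M i k k <= _); last first.
    rewrite lerDr mxdiag_hdot.
    by have [_ /(_ (delta_mx i 0))/andP[]] := compressed_reginv_psd M i e0.
  apply: ler_sum => k ki; rewrite (mxdiag_hdot (compressed_reginv _ _ _)).
  rewrite hdot_compressed_reginv// mxE mxdiag_hdot.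
  suff -> : projC i *m delta_mx k 0 = delta_mx k 0 :> 'cV_n by [].
  apply/matrixP => a b; rewrite ord1 projCE !mxE.
  by have [->|ai] := eqVneq a i; rewrite ?mul1r// mul0r eq_sym (negPf ki).
apply: le_trans trD; rewrite lerD2r !mxtraceZ ler_pM2l//.
apply: le_trans (mxtrace_reginv_le (Y := (D *m M) ^t*) e0 _) _.
  by move=> x; rewrite !trmxCK -mulmxA sqn_projC.
rewrite mxtrace_reginv_flip//.
apply: mxtrace_reginv_le => // x.
by rewrite trCmx_mul projC_adj -mulmxA sqn_projC.
Qed.

(* Test vector [v := S e_i / S_ii]: it has [v_i = 1] and
   [|M v|^2 + e |v|^2 = 1 / S_ii], so column [i] of [M] is, up to a short
   vector, in the image of the other columns on a short vector. *)
Lemma compressed_reginv_col n e (M : 'M[C]_n) i : 0 < e ->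
  let S := reginv e (M ^t*) in
  0 < S i i /\
  hdot (col i M) (compressed_reginv e M i *m col i M) <= (S i i)^-1.
Proof.
move=> e0 S; set D := projC i.
have Sii : S i i = hdot (delta_mx i 0) (S *m delta_mx i 0) by rewrite -mxdiag_hdot.
set y := S *m delta_mx i 0 in Sii.
have Siy : S i i = sqn (M *m y) + e * sqn y.
  by rewrite Sii /y hdot_reginv// trmxCK.
have Sge0 : 0 <= S i i by rewrite Sii hdot_reginv_ge0.
have y0 : y != 0.
  apply/eqP => y0; have := reginvK (M ^t*) (delta_mx i 0 : 'cV_n) e0.
  rewrite -/y -/S -/y y0 mulmx0 => /matrixP/(_ i 0)/eqP.
  by rewrite !mxE !eqxx eq_sym oner_eq0.
have Sgt0 : 0 < S i i.
  rewrite Siy ltr_wpDl ?sqn_ge0// mulr_gt0// lt_neqAle sqn_ge0 andbT eq_sym.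
  by apply: contraNN y0 => /eqP/sqn_eq0/eqP.
split=> //.
set v := (S i i)^-1 *: y.
have vi : v i 0 = 1 by rewrite mxE /y -colE mxE mulVf ?gt_eqF.
have vE : sqn (M *m v) + e * sqn v = (S i i)^-1.
  have Vc : ((S i i)^-1)^* = (S i i)^-1 by rewrite geC0_conj// invr_ge0.
  rewrite /v -scalemxAr !hdotZl !hdotZr Vc.
  rewrite [LHS](_ : _ = (S i i)^-1 * (S i i)^-1 * S i i); last by rewrite Siy; ring.
  by rewrite -mulrA mulVf ?mulr1// gt_eqF.
have ve : v = delta_mx i 0 + D *m v.
  apply/matrixP => k j; rewrite ord1 [RHS]mxE /D projCE [delta_mx _ _ _ _]mxE eqxx andbT.
  by have [->|_] := eqVneq k i; rewrite ?vi ?mul0r ?addr0 ?add0r ?mul1r.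
have xE : D *m col i M = D *m (M *m v) - (D *m M *m D) *m v.
  by rewrite {1}ve mulmxDr mulmxDr -colE -!mulmxA addrK.
rewrite hdot_compressed_reginv// -/D xE.
apply: le_trans (hdot_reginv_range _ _ _ e0) _.
by rewrite -vE lerD2r sqn_projC.
Qed.

(** * Schur complements of positive contractions *)

Lemma hdot_mulmx_conj n (H : 'M[C]_n) x y : H ^t* = H ->
  hdot y (H *m x) = (hdot x (H *m y))^*.
Proof. by move=> Hh; rewrite hdotC hdot_mulmxl Hh. Qed.

(** This is [H^2 <= H] for [0 <= H <= 1]: expand the nonnegative form of [H] at [x - H x] and use
    [H <= 1] at [H x]. *)
Lemma sqn_contraction n (H : 'M[C]_n) x : psd_contraction H ->
  sqn (H *m x) <= hdot x (H *m x).
Proof.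
move=> [Hh H01]; set y := H *m x.
have /andP[+ _] := H01 (x - y); have /andP[_ yHy] := H01 y.
rewrite mulmxBr hdotBr !hdotBl -/y.
have -> : hdot x (H *m y) = sqn y by rewrite hdot_mulmxr Hh.
move=> h; rewrite -subr_ge0; apply: le_trans h _.
rewrite -subr_ge0 (_ : _ - _ = sqn y - hdot y (H *m y)) ?subr_ge0//.
by ring.
Qed.

(* The Schur complement of [H] at the pivot [j], kept at its full size. *)
Definition pivot {n} (H : 'M[C]_n) j : 'M[C]_n :=
  H - (H j j)^-1 *: (col j H *m (col j H) ^t*).

Lemma col_hdot n (H : 'M[C]_n) j x : H ^t* = H ->
  hdot (col j H) x = (H *m x) j 0.
Proof. by move=> Hh; rewrite colE hdot_mulmxl Hh hdot_delta. Qed.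

Lemma hdot_pivot n (H : 'M[C]_n) j x : H ^t* = H ->
  hdot x (pivot H j *m x) = hdot x (H *m x) - (H j j)^-1 * `|(H *m x) j 0| ^+ 2.
Proof.
move=> Hh; rewrite /pivot mulmxBl hdotBr -scalemxAl hdotZr; congr (_ - _ * _).
rewrite -mulmxA hdot_mulmxr hdotE big_ord1 -[(_ *m _) 0 0]/(hdot _ _) col_hdot//.
by rewrite normCK mulrC.
Qed.

(** The upper bound survives because a nonnegative form is subtracted. For the lower bound, the form
    of the Schur complement at [x] is the form of [H] at [x - t e_j], for the [t] that minimizes
    it. *)
Lemma pivot_psd n (H : 'M[C]_n) j : 0 < H j j ->
  psd_contraction H -> psd_contraction (pivot H j).
Proof.
move=> Hj [Hh H01]; split=> [|x].
  rewrite /pivot linearB/= map_mxB/= Hh linearZ/= map_mxZ/= trCmx_mul trmxCK.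
  by rewrite geC0_conj// invr_ge0 ltW.
apply/andP; split; last first.
  have /andP[_] := H01 x; apply: le_trans; rewrite hdot_pivot// gerBl.
  by rewrite mulr_ge0 ?invr_ge0 ?exprn_ge0// ltW.
set t := (H j j)^-1 * (H *m x) j 0.
have /andP[+ _] := H01 (x - t *: delta_mx j 0).
rewrite mulmxBr -scalemxAr hdotBr !hdotBl !hdotZr !hdotZl hdot_delta -mxdiag_hdot.
rewrite [hdot x (H *m delta_mx _ _)]hdot_mulmx_conj// hdot_delta hdot_pivot//.
congr (_ <= _); rewrite normCK /t rmorphM /= fmorphV /= [(H j j)^*]geC0_conj ?ltW//.
have H0 : H j j != 0 by rewrite gt_eqF.
by field.
Qed.

(** The trace lost is [|H e_j|^2 / H_jj], and [|H e_j|^2 <= H_jj] because [H^2 <= H]. *)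
Lemma mxtrace_pivot n (H : 'M[C]_n) j : 0 < H j j -> psd_contraction H ->
  \tr H - 1 <= \tr (pivot H j).
Proof.
move=> Hj HH; rewrite /pivot raddfB/= lerD2l lerN2 mxtraceZ mxtrace_mulC.
rewrite ler_pdivrMl// mulr1 trace_mx11 -[_ 0 0]/(hdot _ _) colE.
by apply: le_trans (sqn_contraction _ HH) _; rewrite -mxdiag_hdot.
Qed.

Lemma pivotE n (H : 'M[C]_n) j k l :
  pivot H j k l = H k l - (H j j)^-1 * (H k j * (H l j)^*).
Proof. by rewrite /pivot !mxE big_ord1 !mxE. Qed.

Lemma pivot_col0 n (H : 'M[C]_n) j k : 0 < H j j -> pivot H j k j = 0.
Proof.
move=> Hj; rewrite pivotE geC0_conj ?ltW// mulrCA mulVf ?mulr1 ?subrr//.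
by rewrite gt_eqF.
Qed.

Lemma pivot_row0 n (H : 'M[C]_n) j k : H ^t* = H -> 0 < H j j ->
  pivot H j j k = 0.
Proof.
move=> Hh Hj; have Hjk : (H k j)^* = H j k by rewrite -[in RHS]Hh !mxE.
by rewrite pivotE Hjk mulrA mulVf ?gt_eqF// mul1r subrr.
Qed.

(** Row and column [j] of the Schur complement vanish. Thus, once pivot [j] has been taken, the
    remaining form no longer sees coordinate [j], which is what allows conditioning on the other
    coordinates. *)
Lemma hdot_pivot_congr n (H : 'M[C]_n) j (x y : 'cV[C]_n) : H ^t* = H -> 0 < H j j ->
  (forall k, k != j -> x k 0 = y k 0) ->
  hdot x (pivot H j *m x) = hdot y (pivot H j *m y).
Proof.
move=> Hh Hj xy; rewrite !hdotE; apply: eq_bigr => k _.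
have [->|kj] := eqVneq k j.
  rewrite [(_ *m x) _ _]mxE [(_ *m y) _ _]mxE !big1 ?mulr0// => l _;
  by rewrite pivot_row0// mul0r.
rewrite xy// !mxE; congr (_ * _); apply: eq_bigr => l _.
by have [->|/xy ->//] := eqVneq l j; rewrite pivot_col0// !mul0r.
Qed.

(** * Functional calculus of a diagonalized matrix *)

Section conjugate_diagonal.
Variables (n : nat) (P : 'M[C]_n).
Hypothesis Punit : P \in unitmx.

Definition diagconj (f : 'I_n -> C) : 'M[C]_n :=
  invmx P *m diag_mx (\row_j f j) *m P.

Lemma diagconjM f g : diagconj f *m diagconj g = diagconj (f \* g).
Proof.
rewrite /diagconj mulmxA -(mulmxA _ P) -!mulmxA (mulmxA P) mulmxV// mul1mx.
congr (_ *m _); rewrite !mulmxA; congr (_ *m _); rewrite mulmx_diag.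
by congr diag_mx; apply/rowP => j; rewrite !mxE.
Qed.

Lemma diagconjD f g : diagconj f + diagconj g = diagconj (f \+ g).
Proof.
rewrite /diagconj -mulmxDl -mulmxDr -raddfD; congr (_ *m diag_mx _ *m _).
by apply/rowP => j; rewrite !mxE.
Qed.

Lemma scalar_diagconj a : a%:M = diagconj (fun=> a).
Proof.
rewrite /diagconj (_ : \row__ _ = const_mx a); last by apply/rowP=> j; rewrite !mxE.
by rewrite diag_const_mx mul_mx_scalar -scalemxAl mulVmx// scalemx1.
Qed.

Lemma invmx_diagconj f : (forall j, f j != 0) ->
  invmx (diagconj f) = diagconj (fun j => (f j)^-1).
Proof.
move=> f0; have fV : diagconj (fun j => (f j)^-1) *m diagconj f = 1%:M.
  rewrite diagconjM scalar_diagconj; congr (_ *m diag_mx _ *m _).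
  by apply/rowP => j; rewrite !mxE/= mulVf.
have [_ fU] := mulmx1_unit fV.
by rewrite -[LHS]mul1mx -fV -mulmxA mulmxV// mulmx1.
Qed.

Lemma mxtrace_diagconj f : \tr (diagconj f) = \sum_j f j.
Proof.
rewrite /diagconj mxtrace_mulC mulmxA mulmxV// mul1mx mxtrace_diag.
by apply: eq_bigr => j _; rewrite mxE.
Qed.

Lemma eq_diagconj f g : f =1 g -> diagconj f = diagconj g.
Proof. by move=> fg; congr (_ *m diag_mx _ *m _); apply/rowP => j; rewrite !mxE. Qed.

Lemma diagconjZ a f : a *: diagconj f = diagconj (fun j => a * f j).
Proof. by rewrite -mul_scalar_mx scalar_diagconj diagconjM; exact: eq_diagconj. Qed.

Lemma iter_diagconj f k :
  iter k (mulmx (diagconj f)) 1%:M = diagconj (fun j => f j ^+ k).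
Proof.
elim: k => [|k ih] /=; first by rewrite scalar_diagconj; exact: eq_diagconj.
by rewrite ih diagconjM; apply: eq_diagconj => j /=; rewrite exprS.
Qed.

Lemma diagconj_unit f : (forall j, f j != 0) -> diagconj f \in unitmx.
Proof.
move=> f0; suff /mulmx1_unit[] : diagconj f *m diagconj (fun j => (f j)^-1) = 1%:M by [].
by rewrite diagconjM scalar_diagconj; apply: eq_diagconj => j /=; rewrite mulfV.
Qed.

Lemma diagconj_threshold X a f k : X = diagconj f ->
  1%:M + iter k (mulmx (a *: X)) 1%:M = diagconj (fun j => 1 + (a * f j) ^+ k).
Proof.
move=> ->; rewrite diagconjZ iter_diagconj scalar_diagconj diagconjD.
exact: eq_diagconj.
Qed.

Lemma mxtrace_diagconj_inv X b : (forall j, b j != 0) -> X = diagconj b ->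
  \tr (2 *: (invmx X *m invmx X) - invmx X) =
  \sum_j (2 * (b j)^-1 ^+ 2 - (b j)^-1).
Proof.
move=> b0 ->; rewrite invmx_diagconj// raddfB/= mxtraceZ diagconjM !mxtrace_diagconj.
by rewrite mulr_sumr -sumrB; apply: eq_bigr => j _; rewrite expr2.
Qed.

End conjugate_diagonal.

Lemma gram_spectral n (M : 'M[C]_n) : let A := M ^t* *m M in
  A = diagconj (spectralmx A) (spectral_diag A 0) /\
  forall j, 0 <= spectral_diag A 0 j.
Proof.
move=> A.
have Ah : A ^t* = A by rewrite /A trCmx_mul trmxCK.
have Anorm : A \is normalmx by apply/normalmxP; rewrite Ah.
have AE : A = diagconj (spectralmx A) (spectral_diag A 0).
  rewrite {1}(orthomx_spectralP Anorm) /diagconj; congr (_ *m diag_mx _ *m _).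
  by apply/rowP => j; rewrite mxE.
split=> // j; set P := spectralmx A in AE.
have PU : P \is unitarymx by exact: spectral_unitarymx.
have : P *m A *m P ^t* = diag_mx (\row_j spectral_diag A 0 j).
  rewrite {1}AE /diagconj !mulmxA mulmxV ?unitarymx_unit// mul1mx.
  by rewrite -mulmxA (unitarymxP PU) mulmx1.
move=> /matrixP/(_ j j); rewrite [RHS]mxE eqxx mulr1n [RHS]mxE => <-.
rewrite mxdiag_hdot -!mulmxA hdot_mulmxr hdot_mulmxr trmxCK.
exact: sqn_ge0.
Qed.

(** The trace is the sum of [e / (d_j + e)] over the eigenvalues; a term with [d_j <= e] is at least
    1/2 and the others are nonnegative. *)
Lemma mxtrace_reginv_count n (e : C) (M : 'M[C]_n) p : 0 < e ->
  (p <= #|[pred j | spectral_diag (M ^t* *m M) ord0 j <= e]%R|)%N ->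
  p%:R / 2 <= \tr (e *: reginv e (M ^t*)).
Proof.
move=> e0 pe; have [] := gram_spectral M; set A := _ *m _; set d := spectral_diag A 0.
move=> AE d0; have PU := spectral_unit A.
have de0 j : d j + e != 0 by rewrite gt_eqF// ltr_wpDl.
have -> : reginv e (M ^t*) = diagconj (spectralmx A) (fun j => (d j + e)^-1).
  rewrite /reginv /reg trmxCK -/A {1}AE (scalar_diagconj PU e) diagconjD.
  by rewrite invmx_diagconj.
rewrite mxtraceZ mxtrace_diagconj// mulr_sumr.
apply: le_trans (_ : \sum_(j in [pred j | d j <= e]) 2^-1 <= _); last first.
  rewrite big_mkcond/=; apply: ler_sum => j _; rewrite inE; case: ifP => h.
    rewrite ler_pdivlMr ?ltr_wpDl// mulrC ler_pdivrMr ?ltr0n//.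
    by rewrite mulr_natr mulr2n lerD2r.
  by rewrite divr_ge0 ?(ltW e0)// addr_ge0// ltW.
rewrite sumr_const -[leRHS]mulr_natl ler_pM2r ?invr_gt0 ?ltr0n// ler_nat.
exact: leq_trans pe _.
Qed.

End hermitian_forms.

(** * Measurable complex matrices *)

Section complex_measurability.
Context {R : realType} {d : measure_display} {T : measurableType d}.
Implicit Types f g : T -> R[i].

Definition cmeasurable f :=
  measurable_fun [set: T] (fun w => complex.Re (f w)) /\
  measurable_fun [set: T] (fun w => complex.Im (f w)).

Lemma cmeasurable_cst (a : R[i]) : cmeasurable (fun=> a).
Proof. by split; exact: measurable_cst. Qed.

Lemma cmeasurable_real (f : T -> R) : measurable_fun [set: T] f ->
  cmeasurable (fun w => (f w)%:C%C).
Proof. by move=> mf; split=> //=; exact: measurable_cst. Qed.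

Lemma cmeasurableD f g : cmeasurable f -> cmeasurable g ->
  cmeasurable (fun w => f w + g w).
Proof.
move=> [f1 f2] [g1 g2]; split.
- rewrite (_ : (fun _ => _) = (fun w => complex.Re (f w) + complex.Re (g w))).
    exact: measurable_funD.
  by apply/funext => w; case: (f w) (g w) => [? ?] [].
- rewrite (_ : (fun _ => _) = (fun w => complex.Im (f w) + complex.Im (g w))).
    exact: measurable_funD.
  by apply/funext => w; case: (f w) (g w) => [? ?] [].
Qed.

Lemma cmeasurableM f g : cmeasurable f -> cmeasurable g ->
  cmeasurable (fun w => f w * g w).
Proof.
move=> [f1 f2] [g1 g2]; split.
- rewrite (_ : (fun _ => _) = (fun w => complex.Re (f w) * complex.Re (g w) -
      complex.Im (f w) * complex.Im (g w))).
    by apply: measurable_funB; exact: measurable_funM.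
  by apply/funext => w; case: (f w) (g w) => [? ?] [].
- rewrite (_ : (fun _ => _) = (fun w => complex.Re (f w) * complex.Im (g w) +
      complex.Im (f w) * complex.Re (g w))).
    by apply: measurable_funD; exact: measurable_funM.
  by apply/funext => w; case: (f w) (g w) => [? ?] [].
Qed.

Lemma cmeasurableN f : cmeasurable f -> cmeasurable (fun w => - f w).
Proof.
move=> mf; rewrite (_ : (fun _ => _) = (fun w => -1 * f w)).
  by apply: cmeasurableM => //; exact: cmeasurable_cst.
by apply/funext => w; rewrite mulN1r.
Qed.

Lemma cmeasurable_conj f : cmeasurable f -> cmeasurable (fun w => (f w)^*%R).
Proof.
move=> [f1 f2]; split.
  rewrite (_ : (fun _ => _) = (fun w => complex.Re (f w)))//.
  by apply/funext => w; case: (f w).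
rewrite (_ : (fun _ => _) = (fun w => - complex.Im (f w))).
  exact: measurable_funN.
by apply/funext => w; case: (f w).
Qed.

Lemma cmeasurableV f : cmeasurable f -> cmeasurable (fun w => (f w)^-1).
Proof.
move=> [f1 f2]; pose n2 w := complex.Re (f w) ^+ 2 + complex.Im (f w) ^+ 2.
have n2_ge0 w : 0 <= n2 w by rewrite addr_ge0// sqr_ge0.
have mn : measurable_fun [set: T] (fun w => (n2 w)^-1).
  (* The real inverse is the power [-1] on nonnegative reals, 0 included, and real powers are
     measurable. *)
  rewrite (_ : (fun _ => _) = (@powR R ^~ (-1)) \o n2).
    apply: measurableT_comp; first exact: measurable_powR.
    by apply: measurable_funD; exact: measurable_funX.
  by apply/funext => w /=; rewrite powR_inv1.
split.
- rewrite (_ : (fun _ => _) = (fun w => complex.Re (f w) * (n2 w)^-1)).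
    exact: measurable_funM.
  by apply/funext => w; rewrite /n2; case: (f w).
- rewrite (_ : (fun _ => _) = (fun w => - (complex.Im (f w) * (n2 w)^-1))).
    by apply: measurable_funN; exact: measurable_funM.
  by apply/funext => w; rewrite /n2; case: (f w).
Qed.

Lemma cmeasurable_sum I (r : seq I) (Q : pred I) (F : I -> T -> R[i]) :
  (forall i, cmeasurable (F i)) -> cmeasurable (fun w => \sum_(i <- r | Q i) F i w).
Proof.
move=> mF; elim: r => [|i r ih].
  rewrite (_ : (fun _ => _) = fun=> 0); first exact: cmeasurable_cst.
  by apply/funext => w; rewrite big_nil.
under [X in cmeasurable X]funext do rewrite big_cons.
by case: (Q i) => //; apply: cmeasurableD.
Qed.

Lemma cmeasurable_prod I (r : seq I) (Q : pred I) (F : I -> T -> R[i]) :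
  (forall i, cmeasurable (F i)) -> cmeasurable (fun w => \prod_(i <- r | Q i) F i w).
Proof.
move=> mF; elim: r => [|i r ih].
  rewrite (_ : (fun _ => _) = fun=> 1); first exact: cmeasurable_cst.
  by apply/funext => w; rewrite big_nil.
under [X in cmeasurable X]funext do rewrite big_cons.
by case: (Q i) => //; apply: cmeasurableM.
Qed.

Definition mxmeasurable {m n} (F : T -> 'M[R[i]]_(m, n)) :=
  forall i j, cmeasurable (fun w => F w i j).

Lemma mxmeasurable_cst m n (A : 'M[R[i]]_(m, n)) : mxmeasurable (fun=> A).
Proof. by move=> i j; exact: cmeasurable_cst. Qed.

Lemma mxmeasurableD m n (F G : T -> 'M[R[i]]_(m, n)) :
  mxmeasurable F -> mxmeasurable G -> mxmeasurable (fun w => F w + G w).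
Proof.
move=> mF mG i j; under [X in cmeasurable X]funext do rewrite mxE.
exact: cmeasurableD.
Qed.

Lemma mxmeasurableM m n p (F : T -> 'M[R[i]]_(m, n)) (G : T -> 'M[R[i]]_(n, p)) :
  mxmeasurable F -> mxmeasurable G -> mxmeasurable (fun w => F w *m G w).
Proof.
move=> mF mG i j; under [X in cmeasurable X]funext do rewrite mxE.
by apply: cmeasurable_sum => k; exact: cmeasurableM.
Qed.

Lemma mxmeasurableZ m n a (F : T -> 'M[R[i]]_(m, n)) : cmeasurable a ->
  mxmeasurable F -> mxmeasurable (fun w => a w *: F w).
Proof.
move=> ma mF i j; under [X in cmeasurable X]funext do rewrite mxE.
exact: cmeasurableM.
Qed.

Lemma mxmeasurable_adj m n (F : T -> 'M[R[i]]_(m, n)) : mxmeasurable F ->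
  mxmeasurable (fun w => (F w) ^t*%sesqui).
Proof.
move=> mF i j; under [X in cmeasurable X]funext do rewrite 2!mxE.
exact: cmeasurable_conj.
Qed.

Lemma cmeasurable_det n (F : T -> 'M[R[i]]_n) : mxmeasurable F ->
  cmeasurable (fun w => \det (F w)).
Proof.
move=> mF; apply: cmeasurable_sum => s; apply: cmeasurableM.
  exact: cmeasurable_cst.
by apply: cmeasurable_prod => i; exact: mF.
Qed.

(** By the cofactor formula the entries of the inverse are rational functions of the entries. *)
Lemma mxmeasurable_inv n (F : T -> 'M[R[i]]_n) : mxmeasurable F ->
  (forall w, F w \in unitmx) -> mxmeasurable (fun w => invmx (F w)).
Proof.
move=> mF uF i j.
rewrite (_ : (fun _ => _) = fun w => (\det (F w))^-1 * cofactor (F w) j i).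
  apply: cmeasurableM; first exact/cmeasurableV/cmeasurable_det.
  apply: cmeasurableM; first exact: cmeasurable_cst.
  apply: cmeasurable_det => a b.
  by under [X in cmeasurable X]funext do rewrite 2!mxE; exact: mF.
by apply/funext => w; rewrite /invmx uF !mxE.
Qed.

Lemma mxmeasurable_reginv m n (e : R) (F : T -> 'M[R[i]]_(n, m)) : 0 < e ->
  mxmeasurable F -> mxmeasurable (fun w => reginv e%:C%C (F w)).
Proof.
move=> e0 mF; apply: mxmeasurable_inv; last by move=> w; rewrite reg_unit// ltcR.
apply: mxmeasurableD; last exact: mxmeasurable_cst.
by apply: mxmeasurableM => //; exact: mxmeasurable_adj.
Qed.

Lemma mxmeasurable_pivot n (F : T -> 'M[R[i]]_n) j : mxmeasurable F ->
  mxmeasurable (fun w => pivot (F w) j).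
Proof.
move=> mF a b; under [X in cmeasurable X]funext do rewrite pivotE.
apply: cmeasurableD => //; apply: cmeasurableN; apply: cmeasurableM.
  exact: cmeasurableV.
by apply: cmeasurableM => //; exact: cmeasurable_conj.
Qed.

Lemma cmeasurable_trace n (F : T -> 'M[R[i]]_n) : mxmeasurable F ->
  cmeasurable (fun w => \tr (F w)).
Proof. by move=> mF; apply: cmeasurable_sum => i; exact: mF. Qed.

Lemma cmeasurable_hdot n (x y : T -> 'cV[R[i]]_n) : mxmeasurable x ->
  mxmeasurable y -> cmeasurable (fun w => hdot (x w) (y w)).
Proof. by move=> mx my; apply: mxmeasurableM => //; exact: mxmeasurable_adj. Qed.

End complex_measurability.

Lemma measurable_le_setT d (T : measurableType d) (R : realType) (h : T -> R) (t : R) :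
  measurable_fun [set: T] h -> measurable [set w | h w <= t].
Proof.
move=> mh; rewrite [X in measurable X](_ : _ = h @^-1` `]-oo, t]).
  by rewrite -[X in measurable X]setTI; apply: mh => //; exact: measurable_itv.
by apply/seteqP; split => w /=; rewrite in_itv.
Qed.

Lemma measurable_ge_setT d (T : measurableType d) (R : realType) (h : T -> R) (t : R) :
  measurable_fun [set: T] h -> measurable [set w | t <= h w].
Proof.
move=> mh; rewrite [X in measurable X](_ : _ = h @^-1` `[t, +oo[).
  by rewrite -[X in measurable X]setTI; apply: mh => //; exact: measurable_itv.
by apply/seteqP; split => w /=; rewrite in_itv/= andbT.
Qed.

(** * Small-ball estimates *)

Section conditional_small_ball.
Context {R : realType} {d : measure_display} {T : measurableType d}.
Variable P : probability T R.
Local Open Scope ereal_scope.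

(** Conditionally on the sigma-algebra generated by [C], every interval of half-length [r] has mass
    at most [q r] under the law of [g]. Testing against the events [E] expresses this without
    conditional laws. *)
Definition spread_given (C : set (set T)) (g : T -> R) (q : R) :=
  forall (E : set T) (x r : R), C.-sigma.-measurable E -> (0 < r)%R ->
    P (E `&` [set w | `|g w + x| <= r]%R) <= (q * r)%:E * P E.

(* [b] is constant up to [r] on each cell of a grid of step [r], and the cells
   belong to the sigma-algebra. *)
Lemma spread_given_shift (C : set (set T)) (g b : T -> R) (q : R) :
  (forall E : set T, C.-sigma.-measurable E -> d.-measurable E) ->
  measurable_fun [set: T] g ->
  measurable_fun [set: g_sigma_algebraType C] b ->
  (0 <= q)%R -> spread_given C g q ->
  forall (E : set T) (r : R), C.-sigma.-measurable E -> (0 < r)%R ->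
    P (E `&` [set w | `|g w + b w| <= r]%R) <= (q * (2 * r))%:E * P E.
Proof.
move=> Cm mg mb q0 gC E r CE r0.
have mbT : measurable_fun [set: T] b.
  by move=> _ Y mY; exact: (Cm _ (mb measurableT Y mY)).
set S := [set w | _]; have mS : measurable S.
  rewrite /S [X in measurable X](_ : _ = (fun w => g w + b w)%R @^-1` `[(- r)%R, r]).
    rewrite -[X in measurable X]setTI.
    have : measurable_fun [set: T] (fun w => g w + b w)%R by exact: measurable_funD.
    by apply => //; exact: measurable_itv.
  by apply/seteqP; split => w /=; rewrite in_itv/= ler_norml.
pose F n := [set w | choice.pickle (Num.floor (b w / r)) = n].
have Fz z : F (choice.pickle z) = b @^-1` `[(z%:~R * r)%R, ((z + 1)%:~R * r)%R[.
  apply/seteqP; split => w /=; rewrite in_itv/= -ler_pdivlMr// -ltr_pdivrMr//.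
    by move=> /(pcan_inj choice.pickleK) <-; exact: floor_itv.
  by rewrite -floor_eq => /eqP <-.
have F0 n : (forall z : int, choice.pickle z <> n) -> F n = set0.
  by move=> zn; apply/seteqP; split => // w /= wn; exact: zn _ wn.
have CF n : C.-sigma.-measurable (F n).
  have [[z <-]|nz] := pselect (exists z : int, choice.pickle z = n).
    rewrite Fz -[X in _ X]setTI.
    exact: (mb measurableT _ (measurable_itv _)).
  rewrite F0; first exact: measurable0.
  by move=> z zn; apply: nz; exists z.
have CEF n : C.-sigma.-measurable (E `&` F n) by exact: measurableI.
have mE : measurable E by exact: Cm.
have EF : \bigcup_n (E `&` F n) = E.
  rewrite -setI_bigcupr; apply/setIidPl => w _.
  by exists (choice.pickle (Num.floor (b w / r))).
have tF : trivIset [set: nat] F.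
  apply/trivIsetP => m n _ _ mn; apply/seteqP; split => // w [Fm Fn].
  by move: mn; rewrite -Fm -Fn eqxx.
have tEF : trivIset [set: nat] (fun n => E `&` F n) by exact: trivIset_setIl.
have tEFS : trivIset [set: nat] (fun n => (E `&` F n) `&` S) by exact: trivIset_setIr.
have mEF n : d.-measurable (E `&` F n) by exact: Cm.
have -> : P E = \sum_(n <oo) P (E `&` F n).
  by rewrite -{1}EF measure_semi_bigcup// EF.
have -> : P (E `&` S) = \sum_(n <oo) P (E `&` F n `&` S).
  rewrite -{1}EF setI_bigcupl measure_semi_bigcup//.
    by move=> n; exact: measurableI.
  by rewrite -setI_bigcupl EF; exact: measurableI.
rewrite -nneseriesZl; last by move=> n _; exact: measure_ge0.
apply: lee_nneseries => [n _ _|n _]; first exact: measure_ge0.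
have [[z <-]|nz] := pselect (exists z : int, choice.pickle z = n); last first.
  rewrite F0; first by rewrite setI0 set0I measure0 mule0.
  by move=> z zn; apply: nz; exists z.
(* On the cell of [z], [b] differs from [z r] by at most [r], so [|g + b| <= r] forces
   [|g + z r| <= 2 r]. The radius doubles here. *)
have r2 : (0 < 2 * r)%R by rewrite mulr_gt0.
apply: le_trans (gC (E `&` F (choice.pickle z)) (z%:~R * r)%R _ (CEF _) r2).
apply: le_measure; rewrite ?inE.
- by apply: measurableI => //; exact: Cm.
- apply: measurableI; first exact: Cm.
  rewrite [X in measurable X](_ : _ =
    (fun w => g w + z%:~R * r)%R @^-1` `[(- (2 * r))%R, (2 * r)%R]).
    rewrite -[X in measurable X]setTI.
    have : measurable_fun [set: T] (fun w => g w + z%:~R * r)%R.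
      by apply: measurable_funD => //; exact: measurable_cst.
    by apply => //; exact: measurable_itv.
  by apply/seteqP; split => w /=; rewrite in_itv/= ler_norml.
rewrite Fz => w [[Ew Fw] Sw]; split; first by split.
move: Fw Sw; rewrite /S /= in_itv/= intrD => /andP[h1 h2].
by rewrite !ler_norml => /andP[h3 h4]; apply/andP; split; lra.
Qed.

End conditional_small_ball.

Lemma ReD (R : pzRingType) (z z' : R[i]) :
  complex.Re (z + z') = complex.Re z + complex.Re z'.
Proof. by case: z z' => [? ?] []. Qed.

Lemma sqr_Re_le (R : rcfType) (z : R[i]) : complex.Re z ^+ 2 <= complex.Re (`|z| ^+ 2).
Proof. by rewrite -add_Re2_Im2 /= lerDl sqr_ge0. Qed.

(** Completing the square at coordinate [j] splits the form into that of the Schur complement plus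
    [H_jj |z|^2]; both are nonnegative, so each is at most [t]. In [z] the shift of [x_j] is
    computed from [x0], hence from the other coordinates only. Its real part is kept because the
    randomness is real. *)
Lemma pivot_bounds (R : rcfType) n (H : 'M[R[i]]_n) j (x x0 : 'cV[R[i]]_n) (t : R) :
  psd_contraction H -> 0 < H j j ->
  (forall k, x0 k 0 = if k == j then 0 else x k 0) ->
  complex.Re (hdot x (H *m x)) <= t ->
  complex.Re (hdot x (pivot H j *m x)) <= t /\
  complex.Re (H j j) * complex.Re (x j 0 + (H j j)^-1 * (H *m x0) j 0) ^+ 2 <= t.
Proof.
move=> Hpsd Hj x0E xt; have [Hh _] := Hpsd.
have [_ /(_ x)/andP[K0 _]] := pivot_psd Hj Hpsd.
have HE : H j j = (complex.Re (H j j))%:C%C.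
  by rewrite RRe_real// ger0_real// ltW.
set h := complex.Re (H j j) in HE *.
have h0 : 0 < h by move: Hj; rewrite HE ltcR.
have HE0 : H j j != 0 by rewrite gt_eqF.
set z := x j 0 + _.
have Hxz : (H *m x) j 0 = H j j * z.
  have xE : x = x0 + x j 0 *: delta_mx j 0.
    apply/matrixP => k l; rewrite ord1 !mxE eqxx andbT x0E.
    by have [->|_] := eqVneq k j; rewrite ?add0r ?mulr1// mulr0 addr0.
  have e : (H *m (x j 0 *: delta_mx j 0 : 'cV_n)) j 0 = x j 0 * H j j.
    exact: mulmx_scale_delta.
  by rewrite {1}xE mulmxDr [LHS]mxE e /z mulrDr mulVKf// mulrC addrC.
have KE : complex.Re (hdot x (pivot H j *m x)) =
    complex.Re (hdot x (H *m x)) - h * complex.Re (`|z| ^+ 2).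
  rewrite hdot_pivot// Hxz normrM exprMn (ger0_norm (ltW Hj)).
  rewrite mulrA (_ : _^-1 * _ ^+ 2 = h%:C%C); last by rewrite expr2 mulKf.
  by case: (hdot _ _) (`|z| ^+ 2) => [a1 a2] [b1 b2] /=; ring.
have hz0 : 0 <= complex.Re (`|z| ^+ 2) by apply: le_trans (sqr_Re_le z); exact: sqr_ge0.
split; first by rewrite KE; apply: le_trans xt; rewrite gerBl mulr_ge0// ltW.
apply: (@le_trans _ _ (h * complex.Re (`|z| ^+ 2))).
  by rewrite ler_pM2l// sqr_Re_le.
by move: K0; rewrite lecE => /andP[_]; rewrite KE subr_ge0 => /le_trans; apply.
Qed.

(** * Small-ball bound for a quadratic form by successive pivots *)

Section random_quadratic_form.
Context {R : realType} {d : measure_display} {T : measurableType d}.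
Variables (P : probability T R) (n : nat) (C : 'I_n -> set (set T)).
Variables (g : 'I_n -> T -> R) (f : 'I_n -> T -> R[i]) (q : R).
Hypothesis Cm : forall j (E : set T), (C j).-sigma.-measurable E -> d.-measurable E.
Hypothesis mg : forall j, measurable_fun [set: T] (g j).
Hypothesis gC : forall j k, k != j ->
  measurable_fun [set: g_sigma_algebraType (C j)] (g k).
Hypothesis fC : forall j k,
  cmeasurable (f k : g_sigma_algebraType (C j) -> R[i]).
Hypothesis q_ge0 : 0 <= q.
Hypothesis spread : forall j, spread_given P (C j) (g j) q.

Let x (w : T) : 'cV[R[i]]_n := \col_k ((g k w)%:C%C + f k w).

Lemma cmeasurable_sub j (h : T -> R[i]) :
  cmeasurable (h : g_sigma_algebraType (C j) -> R[i]) -> cmeasurable h.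
Proof.
by move=> [h1 h2]; split=> _ Y mY; apply: (@Cm j); [exact: h1 | exact: h2].
Qed.

Local Open Scope ereal_scope.

(** Induction on the number [a] of pivots. Large trace provides a diagonal entry of size at least
    [delta / n]; the form being at most [t] then confines the real part of that coordinate to an
    interval, at the cost of one factor. The Schur complement keeps enough trace for [a - 1] further
    pivots, and its event does not involve the coordinate just used. The domain [D] varies in the
    induction, since the choice of the pivot is random. *)
Lemma quadratic_form_small_ball (t delta : R) (a : nat)
    (H : T -> 'M[R[i]]_n) (D : set T) :
  (0 < t)%R -> (0 < delta)%R ->
  (forall j, mxmeasurable (H : g_sigma_algebraType (C j) -> _)) ->
  (forall j, (C j).-sigma.-measurable D) -> d.-measurable D ->
  (forall w, D w -> psd_contraction (H w) /\
     (a%:R - 1 + delta <= complex.Re (\tr (H w)))%R) ->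
  P (D `&` [set w | complex.Re (hdot (x w) (H w *m x w)) <= t]%R) <=
  ((q * (2 * Num.sqrt (t * n%:R / delta))) ^+ a)%:E * P D.
Proof.
move=> t0 d0; set rho := Num.sqrt _.
have mx : mxmeasurable x.
  move=> k l; under [X in cmeasurable X]funext do rewrite mxE.
  apply: cmeasurableD; first exact: cmeasurable_real.
  exact: (@cmeasurable_sub k).
have mHT (K : T -> 'M[R[i]]_n) :
    (forall j, mxmeasurable (K : g_sigma_algebraType (C j) -> _)) -> mxmeasurable K.
  by move=> mK k l; apply: (@cmeasurable_sub k); exact: mK.
have mQ (K : T -> 'M[R[i]]_n) :
    (forall j, mxmeasurable (K : g_sigma_algebraType (C j) -> _)) ->
    d.-measurable [set w | complex.Re (hdot (x w) (K w *m x w)) <= t]%R.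
  move=> mK; apply: measurable_le_setT; apply: (proj1 (cmeasurable_hdot mx _)).
  by apply: mxmeasurableM => //; exact: mHT.
elim: a H D => [|a ih] H D mH CD mD HD.
  by rewrite expr0 mul1e le_measure// inE//; apply: measurableI => //; exact: mQ.
(* [D] is cut into the disjoint pieces [Dj j] on which [j] is the least index of a large diagonal
   entry. Each piece is measurable for every [C k], since [H] is. *)
pose A j := [set w | delta / n%:R <= complex.Re (H w j j)]%R.
pose Dj j := (D `&` A j) `\` \big[setU/set0]_(k < n | (k < j)%N) A k.
have CA j k : (C j).-sigma.-measurable (A k).
  by apply: measurable_ge_setT; have [] := mH j k k.
have CDj j k : (C j).-sigma.-measurable (Dj k).
  apply: measurableD; first exact: measurableI.
  by apply: bigsetU_measurable => l _; exact: CA.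
have mDj j : d.-measurable (Dj j) by exact: (Cm (CDj j j)).
have tDj : trivIset [set: 'I_n] Dj.
  suff dis (j k : 'I_n) : (j < k)%N -> Dj j `&` Dj k = set0.
    apply/trivIsetP => j k _ _ jk.
    by have [/dis//|/dis|/val_inj/eqP] := ltngtP j k; rewrite 1?setIC// (negPf jk).
  move=> jk; apply/seteqP; split => // w [[[_ Aj] _] [_]]; apply.
  by rewrite -bigcup_seq_cond; exists j => //=; rewrite mem_index_enum.
have DE : D = \big[setU/set0]_(j < n) Dj j.
  apply/seteqP; split => w; last first.
    by rewrite -bigcup_seq => -[j _ [[]]].
  move=> Dw; have [[Hh H01] trH] := HD _ Dw.
  have [j Aj] : exists j, A j w.
    apply: contrapT => /forallNP nA.
    have : (complex.Re (\tr (H w)) < a.+1%:R - 1 + delta)%R.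
      (* If every diagonal entry were below [delta / n], the trace would be below [delta]. For
         [n = 0] the sum is empty and is compared with [a + delta > 0] directly. *)
      rewrite /mxtrace (big_morph (@complex.Re R) (@ReD R) (erefl _)).
      have [n0|n0] := posnP n.
        rewrite big1 => [|i _]; last by have := leq_trans (ltn_ord i) (eq_leq n0).
        by rewrite -natr1 addrK ltr_wpDl.
      have lt1 : (\sum_(i < n) complex.Re (H w i i) < \sum_(i < n) (delta / n%:R))%R.
        apply: ltr_sum; first by apply/hasP; exists (Ordinal n0); rewrite ?mem_index_enum.
        by move=> i _; rewrite ltNge; apply/negP; exact: nA.
      apply: lt_le_trans lt1 _; rewrite sumr_const card_ord -[leLHS]mulr_natr.
      rewrite divfK ?pnatr_eq0 -?lt0n//.
      by rewrite -natr1 addrK lerDr.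
    by rewrite ltNge trH.
  have [k /asboolP Ak kmin] := @arg_minnP _ j (fun j => `[< A j w >])
    (@nat_of_ord n) (introT (asboolP _) Aj).
  rewrite -bigcup_seq; exists k; first by rewrite /= mem_index_enum.
  split=> //; rewrite -bigcup_seq_cond => -[l /= /andP[_ lk] Al].
  by have := kmin l (introT (asboolP _) Al); rewrite leqNgt lk.
have tDjS S : trivIset [set: 'I_n] (fun j => Dj j `&` S) by exact: trivIset_setIr.
rewrite {1}DE big_distrl/= measure_bigsetU_ord//; last first.
  by move=> j; apply: measurableI => //; exact: mQ.
rewrite DE measure_bigsetU_ord//.
rewrite ge0_sume_distrr; last by move=> *; exact: measure_ge0.
apply: lee_sum => j _.
have n0 : (0 < n%:R :> R)%R by rewrite ltr0n (leq_trans _ (ltn_ord j)).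
have dn0 : (0 < delta / n%:R)%R by rewrite divr_gt0.
have rho0 : (0 < rho)%R by rewrite sqrtr_gt0; apply: divr_gt0 => //; exact: mulr_gt0.
have HDj w : Dj j w -> [/\ psd_contraction (H w), (0 < H w j j)%R,
    (delta / n%:R <= complex.Re (H w j j))%R & (H w j j = (complex.Re (H w j j))%:C%C)].
  move=> [[Dw Aw] _]; have [Hpsd _] := HD _ Dw.
  have Hjj : (0 <= H w j j)%R.
    by rewrite mxdiag_hdot; have [_ /(_ (delta_mx j ord0)) /andP[]] := Hpsd.
  split=> //; last by rewrite RRe_real// ger0_real.
  by rewrite ltcE/= (ger0_Im Hjj) eqxx (lt_le_trans dn0).
pose x0 w : 'cV[R[i]]_n := \col_k (if k == j then 0 else x w k 0)%R.
pose K w := pivot (H w) j.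
pose beta w := complex.Re (f j w + (H w j j)^-1 * (H w *m x0 w) j 0)%R.
(* Written with [x0], the event of the next step visibly belongs to the sigma-algebra of [C j]; on
   [Dj j] it agrees with the event written with [x]. *)
pose E := Dj j `&` [set w | complex.Re (hdot (x0 w) (K w *m x0 w)) <= t]%R.
have mK k : mxmeasurable (K : g_sigma_algebraType (C k) -> _) by exact: mxmeasurable_pivot.
have mx0 : mxmeasurable (x0 : g_sigma_algebraType (C j) -> _).
  move=> k l; under [X in cmeasurable X]funext do rewrite mxE.
  have [_|kj] := eqVneq k j; first exact: cmeasurable_cst.
  under [X in cmeasurable X]funext do rewrite mxE.
  by apply: cmeasurableD; [apply: cmeasurable_real; exact: gC | exact: fC].
have mbeta : measurable_fun [set: g_sigma_algebraType (C j)] beta.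
  suff : cmeasurable (fun w : g_sigma_algebraType (C j) =>
    f j w + (H w j j)^-1 * (H w *m x0 w) j 0)%R by case.
  apply: cmeasurableD; first exact: fC.
  apply: cmeasurableM; first by apply: cmeasurableV; exact: mH.
  exact: (mxmeasurableM (mH j) mx0).
have CE : (C j).-sigma.-measurable E.
  apply: measurableI; first exact: CDj.
  apply: measurable_le_setT; apply: (proj1 (cmeasurable_hdot mx0 _)).
  exact: mxmeasurableM.
have xx0 w : Dj j w -> hdot (x w) (K w *m x w) = hdot (x0 w) (K w *m x0 w).
  move=> /HDj[[Hh _] Hj _ _]; apply: hdot_pivot_congr => // k kj.
  by rewrite [RHS]mxE (negPf kj).
have EE : E = Dj j `&` [set w | complex.Re (hdot (x w) (K w *m x w)) <= t]%R.
  apply/seteqP; split => w [Dw h]; (split; first exact: Dw).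
    by move: h; rewrite /mkset (xx0 _ Dw).
  by move: h; rewrite /mkset (xx0 _ Dw).
have sub : Dj j `&` [set w | complex.Re (hdot (x w) (H w *m x w)) <= t]%R `<=`
    E `&` [set w | `|g j w + beta w| <= rho]%R.
  move=> w [Dw /= Hw]; have [Hpsd Hj dH HE] := HDj _ Dw.
  have [|h1 h2] := pivot_bounds (x0 := x0 w) Hpsd Hj _ Hw.
    by move=> k; rewrite mxE.
  split; first (rewrite EE; split; [exact: Dw | exact: h1]).
  have q0 : (0 <= t * n%:R / delta)%R.
    by apply: divr_ge0; [apply: mulr_ge0; exact: ltW | exact: ltW].
  rewrite /mkset -sqrtr_sqr (ler_sqrt _ q0).
  have -> : (g j w + beta w = complex.Re (x w j 0 + (H w j j)^-1 * (H w *m x0 w) j 0))%R.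
    have -> : (x w j ord0 = (g j w)%:C%C + f j w)%R by rewrite mxE.
    by rewrite /beta; case: (f j w) ((H w j j)^-1 * (H w *m x0 w) j ord0)%R => [? ?] [? ?];
      exact: addrA.
  rewrite (ler_pdivlMr _ _ d0) mulrC -(ler_pdivrMr _ _ n0) mulrAC.
  apply: le_trans h2; rewrite mulrC [leRHS]mulrC; apply: ler_wpM2l dH; exact: sqr_ge0.
have mg_beta : d.-measurable [set w | `|g j w + beta w| <= rho]%R.
  have mbT : measurable_fun [set: T] beta.
    by move=> _ Y mY; exact: (Cm (mbeta measurableT Y mY)).
  apply: measurable_le_setT; apply: measurableT_comp (measurable_funD (mg j) mbT).
  exact: normr_measurable.
apply: (@le_trans _ _ (P (E `&` [set w | `|g j w + beta w| <= rho]%R))).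
  apply: le_measure; rewrite ?inE; last exact: sub.
    by apply: measurableI; [exact: mDj | exact: mQ].
  by apply: measurableI; [exact: (Cm CE) | exact: mg_beta].
(* The coordinate [j] gives one factor given [E]; the induction hypothesis for the Schur complement
   on [Dj j] gives the other [a]. *)
apply: (@le_trans _ _ ((q * (2 * rho))%:E * P E)).
  exact: (spread_given_shift (@Cm j) (mg j) mbeta q_ge0 (@spread j) CE rho0).
have r20 : (0 <= 2 * rho)%R by apply: mulr_ge0; [exact: ler0n | exact: ltW].
have c0 : 0 <= (q * (2 * rho))%:E by rewrite lee_fin; exact: mulr_ge0.
rewrite exprS [in leRHS]EFinM -muleA; apply: (lee_wpmul2l c0).
rewrite EE; apply: (ih K (Dj j) mK (CDj ^~ j) (mDj j)) => w Dw.
have [Hpsd Hj _ _] := HDj _ Dw; split; first exact: pivot_psd Hj Hpsd.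
have := mxtrace_pivot Hj Hpsd; rewrite lecE ReD => /andP[_].
have [_ +] := HD _ (proj1 (proj1 Dw)); rewrite -natr1 /=.
by move=> h1 h2; apply: le_trans h2; lra.
Qed.

End random_quadratic_form.

(** * Independence of the pairs of entries *)

Section generated.
Context {d : measure_display} {T : measurableType d} {R : realType}.

Lemma generated_sigma_algebra_preimage (I : Type) (X : I -> T -> R) i (B : set R) :
  measurable B -> generated_sigma_algebra X (X i @^-1` B).
Proof.
move=> mB; apply: sub_sigma_algebra; exists i => //.
by exists B => //; rewrite setTI.
Qed.

Lemma generated_sigma_algebra_le (I : Type) (X : I -> T -> R) (S : set (set T)) :
  sigma_algebra [set: T] S ->
  (forall i (B : set R), measurable B -> S (X i @^-1` B)) ->
  generated_sigma_algebra X `<=` S.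
Proof.
move=> Ssigma XS; apply: smallest_sub => // _ [i _ [B mB <-]].
by rewrite setTI; exact: XS.
Qed.

Lemma generated_sigma_algebra_sigma (I : Type) (X : I -> T -> R) :
  sigma_algebra [set: T] (generated_sigma_algebra X).
Proof. exact: smallest_sigma_algebra. Qed.

Lemma generated_sigma_algebra_measurable (I : Type) (X : I -> T -> R) :
  (forall i, measurable_fun [set: T] (X i)) ->
  generated_sigma_algebra X `<=` d.-measurable.
Proof.
move=> mX; apply: generated_sigma_algebra_le.
  exact: sigma_algebra_measurable.
by move=> i B mB; rewrite -[X in measurable X]setTI; exact: mX.
Qed.

Lemma generated_sigma_algebraT (I : Type) (X : I -> T -> R) :
  generated_sigma_algebra X [set: T].
Proof.
exact: (@measurableT _ (g_sigma_algebraType (\bigcup_(i in [set: I])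
  preimage_set_system [set: T] (X i) (@measurable _ R)))).
Qed.

Lemma generated_sigma_algebraI (I : Type) (X : I -> T -> R) E E' :
  generated_sigma_algebra X E -> generated_sigma_algebra X E' ->
  generated_sigma_algebra X (E `&` E').
Proof.
move=> EX EX'; exact: (@measurableI _ (g_sigma_algebraType (\bigcup_(i in [set: I])
  preimage_set_system [set: T] (X i) (@measurable _ R)))).
Qed.

End generated.

Section independent_entries.
Context {d : measure_display} {T : measurableType d} {R : realType} {N : nat}.
Variables (P : probability T R) (G : 'I_N -> 'I_N -> {RV P >-> R}).
Variable A : T -> 'M[R[i]]_N.
Hypothesis Gind : independent_pairs G.
Hypothesis mA : random_cmx A.
Hypothesis GA : independent_of_cmx G A.

Notation index_pair := {p : 'I_N * 'I_N | (p.1 <= p.2)%N}.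

Definition pair_entry (p : index_pair) (b : bool) : T -> R :=
  if b then G (val p).1 (val p).2 : T -> R else G (val p).2 (val p).1.

(** The default [(i, i)] is never reached, as the reordered pair always satisfies the constraint. *)
Definition unordered_pair (i j : 'I_N) : index_pair :=
  insubd (exist _ (i, i) (leqnn i)) (if (i <= j)%N then (i, j) else (j, i)).

Lemma val_unordered_pair i j :
  val (unordered_pair i j) = if (i <= j)%N then (i, j) else (j, i).
Proof.
by rewrite /unordered_pair insubdK// -topredE/=; case: ifPn => //; rewrite -ltnNge => /ltnW.
Qed.

Lemma entry_pair (i j : 'I_N) :
  exists b, (G i j : T -> R) = pair_entry (unordered_pair i j) b.
Proof.
exists (i <= j)%N; rewrite /pair_entry val_unordered_pair.
by case: (i <= j)%N.
Qed.

Lemma unordered_pair_eq (i j k l : 'I_N) :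
  unordered_pair i j = unordered_pair k l -> (i = k /\ j = l) \/ (i = l /\ j = k).
Proof.
move=> /(congr1 val); rewrite !val_unordered_pair.
by case: ifP => _; case: ifP => _ [-> ->]; auto.
Qed.

(* A pi-system generating the sigma-algebra of [A] and of all the entries of
   [G] outside the pair [p]. *)
Definition away_from (p : index_pair) : set (set T) :=
  [set S | exists E A', [/\ forall q, generated_sigma_algebra (pair_entry q) (E q),
     E p = [set: T], generated_sigma_algebra (cmx_coord A) A' &
     S = (\bigcap_q E q) `&` A']].

Lemma away_from_measurable p (E : set T) :
  (away_from p).-sigma.-measurable E -> d.-measurable E.
Proof.
apply: smallest_sub; first exact: sigma_algebra_measurable.
move=> _ [F [A' [Fq _ CA' ->]]]; apply: measurableI.
  apply: fin_bigcap_measurable; first exact: finite_finset.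
  move=> q _; apply: generated_sigma_algebra_measurable (Fq q).
  by case; exact: measurable_funPT.
exact: generated_sigma_algebra_measurable CA'.
Qed.

Lemma away_fromI p : setI_closed (away_from p).
Proof.
move=> _ _ [E [A' [Eq Ep CA' ->]]] [F [B' [Fq Fp CB' ->]]].
exists (fun q => E q `&` F q), (A' `&` B'); split.
- by move=> q; exact: generated_sigma_algebraI.
- by rewrite Ep Fp setTI.
- exact: generated_sigma_algebraI.
- by rewrite bigcapI setIACA.
Qed.

Local Open Scope ereal_scope.

(** Independence of [A] and [G] splits off [A']; independence of the pairs factors the rest. *)
Lemma bigcap_pair_indep (E : index_pair -> set T) A' :
  (forall q, generated_sigma_algebra (pair_entry q) (E q)) ->
  generated_sigma_algebra (cmx_coord A) A' ->
  P ((\bigcap_q E q) `&` A') =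
  (\prod_(q <- fset_set [set: index_pair]) P (E q)) * P A'.
Proof.
move=> Eq CA'; rewrite GA//; last first.
  apply: (@fin_bigcap_measurable _ (g_sigma_algebraType (\bigcup_(i in
    [set: 'I_N * 'I_N]) preimage_set_system [set: T] (G i.1 i.2 : T -> R)
    (@measurable _ R)))); first exact: finite_finset.
  move=> q _; apply: (generated_sigma_algebra_le _ _ (Eq q)).
    exact: generated_sigma_algebra_sigma.
  move=> b Y mY; rewrite /pair_entry; case: b.
    exact: (generated_sigma_algebra_preimage
      (X := fun p : 'I_N * 'I_N => G p.1 p.2 : T -> R) (val q)).
  exact: (generated_sigma_algebra_preimage
      (X := fun p : 'I_N * 'I_N => G p.1 p.2 : T -> R) ((val q).2, (val q).1)).
congr (_ * _).
have := @Gind (fset_set [set: index_pair]) E (fun q _ => Eq q).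
by rewrite fset_setK; [|exact: finite_finset].
Qed.

(** The events independent of [B] form a Dynkin system, so it suffices to treat the generating
    pi-system, where the product formula applies. *)
Lemma pair_indep_away (p : index_pair) B S :
  generated_sigma_algebra (pair_entry p) B -> (away_from p).-sigma.-measurable S ->
  P (B `&` S) = P B * P S.
Proof.
move=> CB.
have mB : d.-measurable B.
  by apply: generated_sigma_algebra_measurable CB; case; exact: measurable_funPT.
have mSs E : (away_from p).-sigma.-measurable E -> d.-measurable E.
  exact: away_from_measurable.
have fin E : d.-measurable E -> P E \is a fin_num by move=> mE; exact: fin_num_measure.
apply: (@dynkin_induction _ (g_sigma_algebraType (away_from p)) (away_from p)
  (fun S => P (B `&` S) = P B * P S)) => //.
- exact: away_fromI.
- by rewrite setIT probability_setT mule1.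
- move=> _ [E [A' [Eq Ep CA' ->]]].
  (* The factor at [p] is the whole space, so intersecting with [B] just replaces that factor. *)
  have -> : B `&` (\bigcap_q E q `&` A') = \bigcap_q (if q == p then B else E q) `&` A'.
    rewrite setIA; congr (_ `&` _); apply/seteqP; split => w.
      by move=> [Bw Ew] q _; case: ifP => // _; exact: Ew.
    move=> h; split; first by have := h p Logic.I; rewrite eqxx.
    by move=> q _; have := h q Logic.I; case: ifPn => // /eqP ->; rewrite Ep.
  rewrite !bigcap_pair_indep//; last by move=> q; case: ifPn => // /eqP ->.
  have pin : p \in fset_set [set: index_pair].
    by rewrite in_fset_set ?in_setT//; exact: finite_finset.
  have split_p (F : index_pair -> set T) :
      \prod_(q <- fset_set [set: index_pair]) P (F q) =
      P (F p) * \prod_(q <- fset_set [set: index_pair] | q != p) P (F q).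
    exact: bigD1_seq pin (fset_uniq _).
  rewrite (split_p E) split_p eqxx Ep probability_setT mul1e muleA.
  by congr (_ * _ * _); apply: eq_bigr => q /negPf ->.
- move=> E CE ihE; have mE := mSs _ CE.
  rewrite -setDE measureD//; [|by rewrite ltey_eq fin].
  rewrite probability_setC// muleBr ?fin//. 
  by rewrite mule1; congr (_ - _); exact: ihE.
- move=> F mF tF ih.
  rewrite setI_bigcupr measure_semi_bigcup//; first last.
  + by apply: bigcupT_measurable => n; apply: measurableI => //; exact: mSs.
  + exact: trivIset_setIl.
  + by move=> n; apply: measurableI => //; exact: mSs.
  rewrite measure_semi_bigcup//; first last.
  + by apply: bigcupT_measurable => n; exact: mSs.
  + by move=> n; exact: mSs.
  rewrite -(fineK (fin _ mB)) -nneseriesZl//.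
  apply: eq_eseriesr => n _; rewrite (fineK (fin _ mB)); exact: ih.
Qed.

End independent_entries.

(** * Conditional spread of the Gaussian entries *)

Lemma normal_peak1_le1 (R : realType) : normal_peak 1 <= 1 :> R.
Proof.
rewrite /normal_peak invf_le1 ?sqrtr_gt0; last first.
  by rewrite expr1n mul1r pmulrn_lgt0// pi_gt0.
rewrite -[leLHS]sqrtr1 ler_wsqrtr// expr1n mul1r.
by have := pi_ge2 R; lra.
Qed.

Lemma normal_prob_itv_le (R : realType) (x r : R) : 0 < r ->
  (normal_prob 0%R 1%R `[(x - r)%R, (x + r)%R]%classic <= (2 * r)%:E)%E.
Proof.
move=> r0; rewrite /normal_prob.
apply: (@le_trans _ _ (\int[lebesgue_measure]_(y in `[(x - r)%R, (x + r)%R])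
    (1%:E : \bar R)))%E.
  apply: ge0_le_integral => //.
  - by move=> y _; rewrite lee_fin normal_pdf_ge0.
  - by apply/measurable_EFinP; apply: measurable_funTS; exact: measurable_normal_pdf.
  - by move=> y _; rewrite lee_fin (le_trans (normal_pdf_ub _ _ _))// normal_peak1_le1.
rewrite integral_cst//= lebesgue_measure_itv/= lte_fin ifT; last by lra.
by rewrite mul1e -EFinD lee_fin; lra.
Qed.

Section entries.
Context {d : measure_display} {T : measurableType d} {R : realType} {N : nat}.
Variables (P : probability T R) (G : 'I_N -> 'I_N -> {RV P >-> R}).
Variable A : T -> 'M[R[i]]_N.
Hypothesis Ggauss : standard_gaussian_entries G.
Hypothesis Gind : independent_pairs G.
Hypothesis mA : random_cmx A.
Hypothesis GA : independent_of_cmx G A.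

Lemma entry_away_from p i j : unordered_pair i j != p ->
  measurable_fun [set: g_sigma_algebraType (away_from G A p)] (G i j : T -> R).
Proof.
move=> ijp _ Y mY; rewrite setTI; apply: sub_sigma_algebra.
have [b Gb] := entry_pair G i j.
exists (fun q => if q == unordered_pair i j then G i j @^-1` Y else [set: T]), [set: T].
split.
- move=> q; case: eqP => [->|_]; last exact: generated_sigma_algebraT.
  by rewrite Gb; exact: (@generated_sigma_algebra_preimage _ _ _ _
    (pair_entry G (unordered_pair i j)) b).
- by rewrite eq_sym (negPf ijp).
- exact: generated_sigma_algebraT.
- rewrite setIT; apply/seteqP; split => w /=; last first.
    by move=> /(_ (unordered_pair i j) Logic.I); rewrite eqxx.
  by move=> Yw q _; case: eqP.
Qed.

Lemma cmx_away_from p i j :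
  cmeasurable (fun w : g_sigma_algebraType (away_from G A p) => A w i j).
Proof.
suff mc q : measurable_fun [set: g_sigma_algebraType (away_from G A p)] (cmx_coord A q).
  by split; [exact: (mc (false, (i, j))) | exact: (mc (true, (i, j)))].
move=> _ Y mY; rewrite setTI; apply: sub_sigma_algebra.
exists (fun=> [set: T]), (cmx_coord A q @^-1` Y); split => //.
- by move=> q'; exact: generated_sigma_algebraT.
- exact: generated_sigma_algebra_preimage.
- by apply/seteqP; split => w; [move=> Yw; split | case].
Qed.

(** The entry is independent of the conditioning sigma-algebra, so its conditional law is Gaussian,
    with density at most 1; an interval of half-length [r] has length [2 r], whence the constant
    2. *)
Lemma entry_spread i j :
  spread_given P (away_from G A (unordered_pair i j)) (G i j) 2.
Proof.
move=> E x r CE r0.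
have -> : [set w | `|G i j w + x| <= r] = G i j @^-1` `[(- x) - r, (- x) + r]%classic.
  apply/seteqP; split => w; rewrite /= in_itv/= ler_norml => /andP[? ?]; apply/andP; split; lra.
rewrite setIC (pair_indep_away Gind mA GA _ CE); last first.
  have [b Gb] := entry_pair G i j.
  rewrite Gb; exact: (@generated_sigma_algebra_preimage _ _ _ _
    (pair_entry G (unordered_pair i j)) b).
apply: lee_wpmul2r; first exact: measure_ge0.
have := Ggauss i j (measurable_itv `[(- x) - r, (- x) + r]).
by rewrite /distribution /pushforward => ->; exact: normal_prob_itv_le.
Qed.

End entries.

(** * Singular values *)

(** In a decreasing list the entries below [x] form a final segment, so [x <= s_m] means that they
    all sit after position [m]. *)
Lemma sorted_nth_count (R : realDomainType) (s : seq R) (x : R) m :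
  sorted >=%R s -> (m < size s)%N ->
  (x <= nth 0 s m) = (count (fun y => y < x)%R s + m < size s)%N.
Proof.
move=> ss ms.
have tr : transitive (>=%R : rel R) by move=> a b c ab bc; exact: le_trans bc ab.
apply/idP/idP => [xm|].
  rewrite -{1}(cat_take_drop m.+1 s) count_cat.
  have /eqP -> : count (fun y => y < x) (take m.+1 s) == 0%N.
    rewrite -leqn0 leqNgt -has_count; apply/hasPn => y /(nthP 0)[k].
    rewrite size_takel// => km <-; rewrite nth_take// -leNgt (le_trans xm)//.
    by apply: (sorted_leq_nth tr (@lexx _ _) 0 ss) => //; rewrite inE (leq_trans km).
  rewrite add0n; have := count_size (fun y => y < x) (drop m.+1 s).
  by rewrite size_drop => h; rewrite -(subnKC ms) addSn ltnS addnC leq_add2l.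
apply: contraTT; rewrite -ltNge -leqNgt => mx.
rewrite -{2}(cat_take_drop m s) count_cat.
have : count (fun y => y < x) (drop m s) = size (drop m s).
  apply/eqP; rewrite -all_count; apply/allP => y /(nthP 0)[k].
  rewrite size_drop => km <-; rewrite nth_drop (le_lt_trans _ mx)//.
  apply: (sorted_leq_nth tr (@lexx _ _) 0 ss); rewrite ?inE ?leq_addr//.
  by rewrite -(subnKC (ltnW ms)) ltn_add2l.
by rewrite size_drop => ->; rewrite -addnA subnK ?leq_addl// ltnW.
Qed.

Section singular_value_count.
Context {R : realType} {N : nat}.
Implicit Type M : 'M[R[i]]_N.

Let lambda M j := spectral_diag (M ^t* *m M)%sesqui ord0 j.

Lemma gram_eigenvalue M j : lambda M j = (complex.Re (lambda M j))%:C%C /\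
  0 <= complex.Re (lambda M j).
Proof.
have [_ /(_ j) l0] := gram_spectral M; split; first by rewrite RRe_real// ger0_real.
by move: l0; rewrite lecE => /andP[].
Qed.

(** Replaces the sorted list by an eigenvalue count, which traces can control. The value numbered
    [N - l] sits at position [N - l - 1], so exactly [l] positions follow it. *)
Lemma singular_value_count M (x : R) l : (l < N)%N -> 0 < x ->
  (x <= singular_value (N - l) M) =
  (#|[pred j | complex.Re (lambda M j) < x ^+ 2]%R| <= l)%N.
Proof.
move=> lN x0.
have ssort : sorted >=%R (singular_values M).
  by apply: sort_sorted => a b; exact: le_total.
have ssize : size (singular_values M) = N.
  by rewrite size_sort size_map size_enum_ord.
rewrite /singular_value sorted_nth_count//; last by rewrite ssize; lia.
rewrite ssize /singular_values count_sort count_map.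
have -> : count (preim (fun j => Num.sqrt (complex.Re (lambda M j))) (fun y => y < x))
   (enum 'I_N) = #|[pred j | complex.Re (lambda M j) < x ^+ 2]%R|.
  rewrite -size_filter cardE {1}enumT; congr size; apply: eq_filter => j.
  rewrite /= -[X in _ < X](gtr0_norm x0) -sqrtr_sqr ltr_sqrt//.
  by rewrite exprn_gt0.
by apply/idP/idP; lia.
Qed.

(** At least [l + 1] eigenvalues lie below [e = x^2], so [e S] has trace at least [(l + 1) / 2]. By
    pigeonhole some [e S_ii] is at least [(l + 1) / (2 N)], and the form on column [i] is at most
    [1 / S_ii]. *)
Lemma small_singular_value_column M (x : R) l : (l < N)%N -> 0 < x ->
  singular_value (N - l) M < x ->
  exists i, let H := compressed_reginv (x ^+ 2)%:C%C M i in
    l.+1%:R / 2 - 1 <= complex.Re (\tr H) /\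
    complex.Re (hdot (col i M) (H *m col i M)) <= 2 * N%:R * x ^+ 2 / l.+1%:R.
Proof.
move=> lN x0; rewrite ltNge singular_value_count// -ltnNge => lcard.
set e := (x ^+ 2)%:C%C; have e0 : 0 < e by rewrite ltcR exprn_gt0.
set S := reginv e (M ^t*)%sesqui.
have trS : l.+1%:R / 2 <= \tr (e *: S).
  apply: mxtrace_reginv_count => //; apply: leq_trans lcard _; apply: subset_leq_card.
  apply/fintype.subsetP => j; rewrite !inE -/(lambda M j) => /ltW lj.
  by have [-> _] := gram_eigenvalue M j; rewrite lecR.
have SE i : S i i = (complex.Re (S i i))%:C%C.
  by have [S0 _] := compressed_reginv_col M i e0; rewrite RRe_real// ger0_real// ltW.
have trE : \tr (e *: S) = (\sum_i x ^+ 2 * complex.Re (S i i))%:C%C.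
  rewrite mxtraceZ /mxtrace mulr_sumr rmorph_sum; apply: eq_bigr => i _.
  by rewrite rmorphM /= -SE.
have pE : l.+1%:R / 2 = (l.+1%:R / 2)%:C%C :> R[i] by rewrite fmorph_div/= !rmorph_nat.
have trR : l.+1%:R / 2 <= \sum_i x ^+ 2 * complex.Re (S i i).
  by move: trS; rewrite trE pE lecR.
have N0 : 0 < N%:R :> R by rewrite ltr0n (leq_ltn_trans _ lN).
have l0 : 0 < l.+1%:R :> R by rewrite ltr0n.
have [i iS] : exists i, l.+1%:R / (2 * N%:R) <= x ^+ 2 * complex.Re (S i i).
  apply: contrapT => /forallNP nS; move: trR; apply/negP; rewrite -ltNge.
  have lt1 : \sum_i x ^+ 2 * complex.Re (S i i) < \sum_(i < N) (l.+1%:R / (2 * N%:R)).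
    apply: ltr_sum; first by apply/hasP; exists (Ordinal lN); rewrite ?mem_index_enum.
    by move=> i _; rewrite ltNge; apply/negP; exact: nS.
  apply: lt_le_trans lt1 _; rewrite sumr_const card_ord -[leLHS]mulr_natr.
  by rewrite le_eqVlt; apply/orP; left; apply/eqP; field; rewrite gt_eqF.
exists i; split.
  have := mxtrace_compressed_reginv M i e0; rewrite -/S trE -(rmorph1 (real_complex R)).
  rewrite -rmorphB lecE => /andP[_]; apply: le_trans => /=.
  by rewrite lerD2r.
have [Sgt0 hS] := compressed_reginv_col M i e0.
have S0 : 0 < complex.Re (S i i) by move: Sgt0; rewrite -/S SE ltcR.
move: hS; rewrite -/S SE -fmorphV lecE => /andP[_] /le_trans; apply => /=.
rewrite -[leLHS]mul1r ler_pdivrMr// mulrAC ler_pdivlMr// mul1r.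
move: iS; rewrite ler_pdivrMr ?mulr_gt0// => /le_trans; apply.
by rewrite le_eqVlt; apply/orP; left; apply/eqP; ring.
Qed.

(** * Measurability of the singular values *)

Lemma cvg_threshold (r : R) : 0 <= r ->
  (fun n => 2 * ((1 + r ^+ n)^-1) ^+ 2 - (1 + r ^+ n)^-1) @ \oo -->
  (((r < 1)%R : nat)%:R : R).
Proof.
move=> r0.
have lim1 (s : R) : 0 <= s < 1 -> (fun n => (1 + s ^+ n)^-1) @ \oo --> (1 : R).
  move=> /andP[s0 s1]; rewrite -[X in _ --> X](_ : (1 + 0)^-1 = _); last first.
    by rewrite addr0 invr1.
  apply: cvgV; first by rewrite addr0 oner_eq0.
  apply: cvgD; first exact: cvg_cst.
  by apply: cvg_expr; rewrite ger0_norm.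
(* The limit [l] is 1, 1/2 or 0 according as [r] is below, equal to or above 1. The polynomial
   [2 l^2 - l] fixes 0 and 1 and sends the borderline value 1/2 to 0. *)
suff [l hl <-] : exists2 l : R, (fun n => (1 + r ^+ n)^-1) @ \oo --> l &
    2 * l ^+ 2 - l = ((r < 1)%R : nat)%:R :> R.
  rewrite /=; apply: cvgB => //; apply: cvgM; first exact: cvg_cst.
  by under eq_fun do rewrite expr2; apply: cvgM.
have [r1|r1|r1] := ltgtP r 1.
- by exists 1; [apply: lim1; rewrite r0 | rewrite /=; ring].
- exists 0; last by rewrite /=; ring.
  (* Passing to [1 / r] reduces this case to a ratio below 1. *)
  have -> : (fun n => (1 + r ^+ n)^-1) = (fun n => 1 - (1 + (r^-1) ^+ n)^-1).
    apply/funext => n; have rn : 0 < r ^+ n by rewrite exprn_gt0// (lt_trans ltr01).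
    rewrite exprVn; field; apply/andP; split; lra.
  rewrite -[X in _ --> X](subrr 1); apply: cvgB; first exact: cvg_cst.
  by apply: lim1; rewrite invr_ge0 r0 invf_lt1// (lt_trans ltr01).
- exists 2^-1; last by rewrite /=; field.
  rewrite r1; under eq_fun do rewrite expr1n; exact: cvg_cst.
Qed.

Lemma singular_value_ge0 M j : 0 <= singular_value j M.
Proof.
rewrite /singular_value; have [js|js] := ltnP j.-1 (size (singular_values M)); last first.
  by rewrite nth_default.
have /allP : all (fun y => 0 <= y) (singular_values M).
  by rewrite /singular_values all_sort all_map; apply/allP => k _ /=; exact: sqrtr_ge0.
by apply; exact: mem_nth.
Qed.

(* Used for measurability: for [b = (1 + r ^ n)^-1], the limit of [2 b ^ 2 - b]
   is 1 if [0 <= r < 1] and 0 if [r >= 1], so that the trace of [2 B ^ 2 - B],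
   where [B] is the inverse of this matrix, tends to the number of eigenvalues of
   [M^* M] below [x ^ 2]. *)
Definition threshold_matrix M (x : R) n : 'M[R[i]]_N :=
  1%:M + iter n (mulmx ((x ^- 2)%:C%C *: (M ^t* *m M)%sesqui)) 1%:M.

Lemma threshold_matrixE M (x : R) n :
  let P := spectralmx (M ^t* *m M)%sesqui in
  threshold_matrix M x n =
  diagconj P (fun j => (1 + (complex.Re (lambda M j) / x ^+ 2) ^+ n)%:C%C).
Proof.
move=> P; have PU : P \in unitmx by exact: spectral_unit.
have [AE _] := gram_spectral M.
rewrite /threshold_matrix (diagconj_threshold PU _ _ AE).
apply: eq_diagconj => j /=; rewrite rmorphD rmorph1 rmorphXn; congr (_ + _ ^+ _).
by have [lE _] := gram_eigenvalue M j; rewrite rmorphM/= -lE mulrC.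
Qed.

Lemma threshold_base_gt0 M (x : R) n j :
  0 < 1 + (complex.Re (lambda M j) / x ^+ 2) ^+ n.
Proof.
have [_ l0] := gram_eigenvalue M j.
by rewrite ltr_wpDr// exprn_ge0// divr_ge0// sqr_ge0.
Qed.

Lemma threshold_matrix_unit M (x : R) n : threshold_matrix M x n \in unitmx.
Proof.
rewrite threshold_matrixE diagconj_unit ?spectral_unit// => j.
by rewrite gt_eqF// ltcR threshold_base_gt0.
Qed.

Lemma threshold_trace M (x : R) n :
  let B := invmx (threshold_matrix M x n) in
  complex.Re (\tr (2 *: (B *m B) - B)) =
  \sum_j (2 * ((1 + (complex.Re (lambda M j) / x ^+ 2) ^+ n)^-1) ^+ 2 -
     (1 + (complex.Re (lambda M j) / x ^+ 2) ^+ n)^-1).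
Proof.
move=> B; have PU := spectral_unit (M ^t* *m M)%sesqui.
rewrite /B (mxtrace_diagconj_inv PU _ (threshold_matrixE M x n)); last first.
  by move=> j; rewrite gt_eqF// ltcR threshold_base_gt0.
set b := fun j => (1 + (complex.Re (lambda M j) / x ^+ 2) ^+ n)^-1.
rewrite [X in complex.Re X](_ : _ = (\sum_j (2 * b j ^+ 2 - b j))%:C%C)//.
rewrite rmorph_sum; apply: eq_bigr => j _.
by rewrite rmorphB rmorphM rmorphXn rmorph_nat /b fmorphV.
Qed.

(** For [x > 0] the event says that at most [l] eigenvalues of [M^* M] are below [x^2]. This count
    is a pointwise limit of traces of rational expressions in the entries, hence measurable. *)
Lemma measurable_singular_value_ge d (T : measurableType d)
    (M : T -> 'M[R[i]]_N) (x : R) l : mxmeasurable M -> (l < N)%N ->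
  measurable [set w | x <= singular_value (N - l) (M w)].
Proof.
move=> mM lN; have [x0|x0] := leP x 0.
  rewrite [X in measurable X](_ : _ = [set: T])//; apply/seteqP; split => // w _.
  exact: le_trans (singular_value_ge0 _ _).
pose h n w := let B := invmx (threshold_matrix (M w) x n) in
  complex.Re (\tr (2 *: (B *m B) - B)).
pose cnt w : R := \sum_j ((complex.Re (lambda (M w) j) / x ^+ 2 < 1)%R : nat)%:R.
have mh n : measurable_fun [set: T] (h n).
  suff mB : mxmeasurable (fun w => invmx (threshold_matrix (M w) x n)).
    apply: (proj1 (cmeasurable_trace _)).
    under [X in mxmeasurable X]funext do rewrite -scaleN1r.
    apply: mxmeasurableD; apply: mxmeasurableZ => //; try exact: cmeasurable_cst.
    exact: mxmeasurableM.
  apply: mxmeasurable_inv => [|w]; last exact: threshold_matrix_unit.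
  apply: mxmeasurableD; first exact: mxmeasurable_cst.
  elim: n => [|n ih] /=; first exact: mxmeasurable_cst.
  apply: mxmeasurableM => //; apply: mxmeasurableZ; first exact: cmeasurable_cst.
  by apply: mxmeasurableM => //; exact: mxmeasurable_adj.
have mcnt : measurable_fun [set: T] cnt.
  apply: (measurable_fun_cvg mh) => w _.
  have -> : h ^~ w = (fun n => \sum_j
      (2 * ((1 + (complex.Re (lambda (M w) j) / x ^+ 2) ^+ n)^-1) ^+ 2 -
      (1 + (complex.Re (lambda (M w) j) / x ^+ 2) ^+ n)^-1)).
    by apply/funext => n; exact: threshold_trace.
  apply: cvg_big => [|j _]; first exact: add_continuous.
  apply: cvg_threshold.
  by have [_ l0] := gram_eigenvalue (M w) j; rewrite divr_ge0// sqr_ge0.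
rewrite [X in measurable X](_ : _ = [set w | cnt w <= l%:R]).
  exact: measurable_le_setT.
apply/seteqP; split => w /=; rewrite singular_value_count// -(ler_nat R);
  rewrite /cnt -natr_sum; set a := (\sum_(i < N) _)%N;
  (suff -> : a = #|[pred j | complex.Re (lambda (M w) j) < x ^+ 2]%R| by []);
  rewrite /a -sum1_card [RHS]big_mkcond/=; apply: eq_bigr => j _;
  by rewrite inE ltr_pdivrMr ?exprn_gt0// mul1r; case: ifP.
Qed.

End singular_value_count.

(** * Probability that one singular value is small *)

Lemma measure_bigsetU_le d (T : measurableType d) (R : realType)
    (mu : {measure set T -> \bar R}) (I : Type) (r : seq I) (F : I -> set T) :
  (forall i, measurable (F i)) ->
  (mu (\big[setU/set0]_(i <- r) F i) <= \sum_(i <- r) mu (F i))%E.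
Proof.
move=> mF; elim: r => [|i r ih]; first by rewrite !big_nil measure0.
rewrite !big_cons; apply: le_trans (measureU2 _ _ _) _ => //.
  by apply: bigsetU_measurable => j _.
exact: leeD2l.
Qed.

Lemma projC_sandwich (C : numClosedFieldType) n (M : 'M[C]_n) i a b :
  (projC i *m M *m projC i) a b =
  if (a != i) && (b != i) then M a b else 0.
Proof.
have rowE (X : 'M[C]_n) : (projC i *m X) a b = (a != i)%:R * X a b.
  have := projCE i (col b X) a; rewrite [col b X a 0]mxE => <-.
  by rewrite [LHS]mxE [RHS]mxE; apply: eq_bigr => k _; rewrite [col _ _ _ _]mxE.
rewrite -mulmxA rowE.
have -> : (M *m projC i) a b = M a b * (b != i)%:R.
  rewrite /projC mulmxBr mulmx1 2!mxE [(M *m delta_mx i i) a b]mxE (bigD1 i)//= big1 => [|k ki].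
    rewrite mxE eqxx/= addr0; have [->|_] := eqVneq b i; first by rewrite mulr1 mulr0 subrr.
    by rewrite mulr0 subr0 mulr1.
  by rewrite mxE (negPf ki) mulr0.
by case: (a != i) (b != i) => [] [] /=; rewrite ?(mul1r, mulr1, mul0r, mulr0).
Qed.

Section main.
Context {d : measure_display} {T : measurableType d} {R : realType} {N : nat}.
Variables (P : probability T R) (G : 'I_N -> 'I_N -> {RV P >-> R}).
Variable A : T -> 'M[R[i]]_N.
Hypothesis Ggauss : standard_gaussian_entries G.
Hypothesis Gind : independent_pairs G.
Hypothesis mA : random_cmx A.
Hypothesis GA : independent_of_cmx G A.

Let M w := cmx_of_RV G w + A w.

Lemma mxmeasurable_sum : mxmeasurable M.
Proof.
apply: mxmeasurableD => i j.
  under [X in cmeasurable X]funext do rewrite mxE.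
  by apply: cmeasurable_real; exact: measurable_funPT.
by split; [exact: (mA (false, (i, j))) | exact: (mA (true, (i, j)))].
Qed.

Let C i j := away_from G A (unordered_pair j i).

(** The compressed matrix only involves entries of [M] with both indices different from [i], and
    none of these lies in the pair of [(j, i)]. *)
Lemma compressed_measurable i j (e : R) : 0 < e ->
  mxmeasurable (fun w : g_sigma_algebraType (C i j) => compressed_reginv e%:C%C (M w) i).
Proof.
move=> e0; apply: mxmeasurableZ; first exact: cmeasurable_cst.
apply: mxmeasurableM; last exact: mxmeasurable_cst.
apply: mxmeasurableM; first exact: mxmeasurable_cst.
apply: mxmeasurable_reginv => // a b.
under [X in cmeasurable X]funext do rewrite projC_sandwich.
have [_|ai] := eqVneq a i => /=; first exact: cmeasurable_cst.
have [_|bi] := eqVneq b i => /=; first exact: cmeasurable_cst.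
under [X in cmeasurable X]funext do rewrite 2!mxE.
apply: cmeasurableD; last exact: cmx_away_from.
apply: cmeasurable_real; apply: entry_away_from.
apply/eqP => /unordered_pair_eq[[_ /eqP]|[/eqP + _]]; first by rewrite (negPf bi).
by rewrite (negPf ai).
Qed.

Definition bad_column (x : R) l i : set T :=
  [set w | l.+1%:R / 2 - 1 <=
    complex.Re (\tr (compressed_reginv (x ^+ 2)%:C%C (M w) i))] `&`
  [set w | complex.Re (hdot (col i (M w))
      (compressed_reginv (x ^+ 2)%:C%C (M w) i *m col i (M w))) <=
    2 * N%:R * x ^+ 2 / l.+1%:R].

(** The small-ball bound is used with [p = l + 1], [delta = p / 4] and [p / 4] pivots rounded down:
    then [a - 1 + delta <= p / 2 - 1], the available trace. The entries of column [i] lie in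
    distinct pairs, which gives the conditional spread. *)
Lemma probability_bad_column (x : R) l i : 0 < x ->
  d.-measurable (bad_column x l i) /\
  (P (bad_column x l i) <=
    ((2 * (2 * Num.sqrt (2 * N%:R * x ^+ 2 / l.+1%:R * N%:R / (l.+1%:R / 4))))
      ^+ (l.+1 %/ 4))%:E)%E.
Proof.
move=> x0; have x20 : 0 < x ^+ 2 by rewrite exprn_gt0.
pose H w := compressed_reginv (x ^+ 2)%:C%C (M w) i.
pose D := [set w | l.+1%:R / 2 - 1 <= complex.Re (\tr (H w))].
have mHC j : mxmeasurable (H : g_sigma_algebraType (C i j) -> _) by exact: compressed_measurable.
have CD j : (C i j).-sigma.-measurable D.
  by apply: measurable_ge_setT; apply: (proj1 (cmeasurable_trace _)); exact: mHC.
have CmT j (E : set T) : (C i j).-sigma.-measurable E -> d.-measurable E.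
  by exact: away_from_measurable.
have mD : d.-measurable D by exact: CmT (CD i).
have mH : mxmeasurable H.
  by move=> a b; apply: (cmeasurable_sub (@CmT) (j := i)); exact: mHC.
have mcol : mxmeasurable (fun w => col i (M w)).
  by move=> a b; under [X in cmeasurable X]funext do rewrite mxE; exact: mxmeasurable_sum.
have N0 : 0 < N%:R :> R by rewrite ltr0n (leq_ltn_trans _ (ltn_ord i)).
have l0 : 0 < l.+1%:R :> R by rewrite ltr0n.
split.
  apply: measurableI => //; apply: measurable_le_setT.
  apply: (proj1 (cmeasurable_hdot mcol _)).
  exact: mxmeasurableM.
have gC j k : k != j -> measurable_fun [set: g_sigma_algebraType (C i j)] (G k i : T -> R).
  move=> kj; apply: entry_away_from.
  apply/eqP => /unordered_pair_eq[[/eqP]|[/eqP ki /eqP ij]].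
    by rewrite (negPf kj).
  by move: kj; rewrite (eqP ki) ij.
have fC j k : cmeasurable (fun w : g_sigma_algebraType (C i j) => A w k i).
  exact: cmx_away_from.
have sp j : spread_given P (C i j) (G j i) 2 by exact: entry_spread.
have mG j : measurable_fun [set: T] (G j i : T -> R) by exact: measurable_funPT.
have t0 : 0 < 2 * N%:R * x ^+ 2 / l.+1%:R.
  by apply: divr_gt0 => //; apply: mulr_gt0 => //; apply: mulr_gt0.
have delta0 : 0 < l.+1%:R / 4 :> R by exact: divr_gt0.
have HD w : D w -> psd_contraction (H w) /\
    ((l.+1 %/ 4)%:R - 1 + l.+1%:R / 4 <= complex.Re (\tr (H w))).
  move=> Dw; split; first by apply: compressed_reginv_psd; rewrite ltcR.
  apply: le_trans Dw.
  have : (l.+1 %/ 4 * 4)%:R <= l.+1%:R :> R by rewrite ler_nat leq_trunc_div.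
  by rewrite natrM; lra.
have := @quadratic_form_small_ball R d T P N (C i) (fun j => G j i) (fun j w => A w j i) 2
  CmT mG gC fC (ler0n _ 2) sp (2 * N%:R * x ^+ 2 / l.+1%:R) (l.+1%:R / 4) (l.+1 %/ 4) H D
  t0 delta0 mHC CD mD HD.
have colE w : \col_k ((G k i w)%:C%C + A w k i) = col i (M w).
  by apply/matrixP => a b; rewrite !mxE.
under [in X in (X <= _)%E -> _]eq_set do rewrite colE.
move=> h; apply: le_trans h _; rewrite -[leRHS]mule1; apply: lee_wpmul2l.
  by rewrite lee_fin exprn_ge0// mulr_ge0// mulr_ge0// sqrtr_ge0.
exact: probability_le1.
Qed.

Lemma small_singular_value_bad_column (x : R) l : (l < N)%N -> 0 < x ->
  [set w | singular_value (N - l) (M w) < x] `<=`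
  \big[setU/set0]_(i < N) bad_column x l i.
Proof.
move=> lN x0 w /(small_singular_value_column lN x0)[i iH].
by rewrite -bigcup_seq; exists i; rewrite //= mem_index_enum.
Qed.

Lemma measurable_sum_singular_value_ge (x : R) l : (l < N)%N ->
  measurable [set w | x <= singular_value (N - l) (M w)].
Proof. by move=> lN; apply: measurable_singular_value_ge => //; exact: mxmeasurable_sum. Qed.

Lemma probability_small_singular_value (c : R) l : 0 < c -> (0 < l < N)%N ->
  12 * c <= expR (- 1) ->
  (P [set w | singular_value (N - l) (M w) < c * l%:R / N%:R]%R <=
     (N%:R * expR (- (l.+1 %/ 4)%:R))%:E)%E.
Proof.
move=> c0 /andP[l0 lN] c12; set x := c * l%:R / N%:R.
have N0 : 0 < N%:R :> R by rewrite ltr0n (leq_ltn_trans _ lN).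
have lR : 0 < l%:R :> R by rewrite ltr0n.
have x0 : 0 < x by rewrite divr_gt0// mulr_gt0.
have mS : measurable [set w | singular_value (N - l) (M w) < x].
  rewrite [X in measurable X](_ : _ = ~` [set w | x <= singular_value (N - l) (M w)]).
    by apply: measurableC; exact: measurable_sum_singular_value_ge.
  by apply/seteqP; split => w /=; rewrite ltNge => /negP.
have mB i : measurable (bad_column x l i) by have [] := probability_bad_column l i x0.
apply: (@le_trans _ _ (P (\big[setU/set0]_(i < N) bad_column x l i))).
  apply: le_measure; rewrite ?inE//; last exact: small_singular_value_bad_column.
  by apply: bigsetU_measurable => i _; exact: mB.
apply: le_trans (measure_bigsetU_le _ _ mB) _.
apply: (@le_trans _ _ (\sum_(i < N) (expR (- (l.+1 %/ 4)%:R))%:E)%E); last first.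
  by rewrite sumEFin sumr_const card_ord -[X in (X%:E <= _)%E]mulr_natl.
apply: lee_sum => i _; have [_] := probability_bad_column l i x0.
move=> h; apply: le_trans h _; rewrite lee_fin.
rewrite -[X in expR (- X)]mulr1 -mulrN expRM_natl.
apply: lerXn2r; rewrite ?nnegrE ?expR_ge0//.
apply: le_trans c12.
(* Each pivot costs [4] times this square root, hence at most [12 c <= 1 / e]. For [x = c l / N] the
   radicand is [8 c^2 (l / (l + 1))^2], below [9 c^2]. *)
suff : Num.sqrt (2 * N%:R * x ^+ 2 / l.+1%:R * N%:R / (l.+1%:R / 4)) <= 3 * c.
  by lra.
rewrite -[leRHS]ger0_norm; last by lra.
rewrite -sqrtr_sqr ler_wsqrtr//.
rewrite [leLHS](_ : _ = 8 * c ^+ 2 * (l%:R / l.+1%:R) ^+ 2); last first.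
  by rewrite /x; field; rewrite !gt_eqF.
have : (l%:R / l.+1%:R : R) ^+ 2 <= 1.
  by rewrite expr_le1// ?divr_ge0// ler_pdivrMr// mul1r ler_nat.
have : 0 < c ^+ 2 by rewrite exprn_gt0.
move=> c2 u1; rewrite [leRHS]exprMn; apply: (@le_trans _ _ (8 * c ^+ 2)).
  by rewrite ler_piMr// mulr_ge0// ltW.
by rewrite ler_pM2r// -natrX ler_nat.
Qed.

End main.

(** * Choice of the constant and union bound over the indices *)

Theorem lemmaA6 (R : realType) :
  exists c : R, 0 < c /\
  forall (d : measure_display) (T : measurableType d) (P : probability T R)
    (N : nat) (G : 'I_N -> 'I_N -> {RV P >-> R}) (A : T -> 'M[R[i]]_N) (k : R),
  (0 < N)%N ->
  standard_gaussian_entries G ->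
  independent_pairs G ->
  random_cmx A ->
  independent_of_cmx G A ->
  c^-1 * ln N%:R <= k ->
  let event := [set w : T | forall l : nat, k <= l%:R -> (l <= N - 1)%N ->
    c * l%:R / N%:R <= singular_value (N - l) (cmx_of_RV G w + A w)] in
  measurable event /\ ((1 - expR (- (c * k)))%:E <= P event)%E.
Proof.
have c0 : 0 < 100^-1 :> R by rewrite invr_gt0.
have c12 : 12 * 100^-1 <= expR (- 1) :> R.
  have h := expR_ge1Dx (- 2^-1 : R).
  have -> : - 1 = - 2^-1 + - 2^-1 :> R by field.
  by rewrite expRD; nra.
exists 100^-1; split => // d T P N G A k N0 Ggauss Gind mA GA; rewrite invrK => Nk event.
pose F l := [set w |
  singular_value (N - l) (cmx_of_RV G w + A w) < 100^-1 * l%:R / N%:R].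
pose good l := [set w |
  100^-1 * l%:R / N%:R <= singular_value (N - l) (cmx_of_RV G w + A w)].
have mgood l : (l < N)%N -> measurable (good l).
  exact: measurable_sum_singular_value_ge.
have FE l : F l = ~` good l.
  by apply/seteqP; split => w /=; rewrite /F/= ltNge => /negP.
have evE : event = \bigcap_(l in [set l | k <= l%:R /\ (l < N)%N]) good l.
  apply/seteqP; split => w /= h l.
    by move=> [kl lN]; apply: h => //; lia.
  by move=> kl lN; apply: h; split => //; lia.
have mev : measurable event.
  by rewrite evE; apply: bigcap_measurableType => l [_ lN]; exact: mgood.
split=> //.
pose r := [seq l <- iota 1 N.-1 | k <= l%:R].
have rP l : l \in r -> k <= l%:R /\ (0 < l < N)%N.
  by rewrite mem_filter mem_iota => /andP[-> h]; split => //; lia.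
(* The index 0, absent from [r], cannot fail: its threshold is 0. The guard [l < N] makes every
   member of the family measurable, as the union bound requires. *)
have evC : ~` event `<=` \big[setU/set0]_(l <- r) (if (l < N)%N then F l else set0).
  rewrite evE setC_bigcap => w [l [kl lN] nl].
  rewrite -bigcup_seq; exists l; last by rewrite lN FE.
  rewrite /= mem_filter kl mem_iota /=.
  suff : (0 < l)%N by lia.
  rewrite lt0n; apply/eqP => l0; apply: nl; rewrite /good /= l0 mulr0 mul0r.
  exact: singular_value_ge0.
have bound : (P (~` event) <= (expR (- (100^-1 * k)))%:E)%E.
  have mF l : measurable (if (l < N)%N then F l else set0).
    by case: ifP => // lN; rewrite FE; apply: measurableC; exact: mgood.
  apply: (@le_trans _ _ (P (\big[setU/set0]_(l <- r) (if (l < N)%N then F l else set0)))).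
    apply: le_measure; rewrite ?inE//; first exact: measurableC.
    by apply: bigsetU_measurable => l _.
  apply: le_trans (measure_bigsetU_le _ _ mF) _.
  have Nr l : l \in r -> (1 < N)%N by move=> /rP[_]; lia.
  (* An empty list covers [N = 1]. Otherwise [N >= 2], so [k >= 100 ln 2 >= 50], which absorbs the
     rounding losses. *)
  case: (posnP (size r)) => [/size0nil ->|r0]; first by rewrite big_nil lee_fin expR_ge0.
  have N2 : (1 < N)%N by apply: (Nr (nth 0%N r 0)); exact: mem_nth.
  have NE : N%:R = expR (ln N%:R) :> R by rewrite lnK// posrE ltr0n.
  have k50 : 50 <= k.
    have ln2 : 2^-1 <= ln (2 : R).
      have := @le_ln1Dx R (- 2^-1); have -> : 1 + - 2^-1 = 2^-1 :> R by field.
      by rewrite lnV ?posrE//; lra.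
    have : ln (2 : R) <= ln N%:R by rewrite ler_ln ?posrE ?ltr0n// ler_nat.
    lra.
  (* Uses [4 * ((l + 1) %/ 4) >= l - 2 >= k - 2]. *)
  pose b := N%:R * expR (- ((k - 2) / 4)).
  have Fb l : l \in r -> (P (if (l < N)%N then F l else set0) <= b%:E)%E.
    move=> lr; have [kl lN] := rP l lr; have /andP[_ ->] := lN.
    apply: le_trans (probability_small_singular_value Ggauss Gind mA GA c0 lN c12) _.
    rewrite lee_fin ler_pM2l ?ltr0n// ler_expR lerN2 ler_pdivrMr//.
    have : (l%:R <= (l.+1 %/ 4 * 4 + 2)%:R :> R) by rewrite ler_nat; lia.
    by rewrite natrD natrM; lra.
  rewrite big_seq; apply: le_trans (lee_sum (g := fun=> b%:E) _ Fb) _.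
  rewrite -big_seq sumEFin lee_fin big_const_seq count_predT iter_addr_0.
  have b0 : 0 <= b by rewrite mulr_ge0// expR_ge0.
  apply: (@le_trans _ _ (N%:R * b)).
    rewrite -[leLHS]mulr_natl ler_wpM2r// ler_nat.
    rewrite (leq_trans (size_subseq (filter_subseq _ _)))//.
    by rewrite size_iota leq_pred.
  (* The exponent is [2 ln N - (k - 2) / 4] with [2 ln N <= k / 50]; it is at most [- k / 100]
     because [k >= 50]. *)
  rewrite /b NE -!expRD ler_expR; lra.
rewrite -[event]setCK probability_setC; last exact: measurableC.
by rewrite EFinB leeB.
Qed.
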